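(* Let $A$ be a $4$-dimensional non-split non-Lie nilpotent Leibniz algebra over $\mathbb{C}$. Then $A$ is isomorphic to a Leibniz algebra with basis $\{x_1,x_2,x_3,x_4\}$ whose nonzero products of basis elements are given by one of the following: $\mathcal{A}_1$: $[x_1,x_3]=x_4,\ [x_3,x_2]=x_4$. $\mathcal{A}_2$: $[x_1,x_3]=x_4,\ [x_2,x_2]=x_4,\ [x_2,x_3]=x_4,\ [x_3,x_1]=x_4,\ [x_3,x_2]=-x_4$. $\mathcal{A}_3$: $[x_1,x_2]=x_4,\ [x_2,x_1]=-x_4,\ [x_3,x_3]=x_4$. $\mathcal{A}_4$: $[x_1,x_2]=x_4,\ [x_2,x_1]=-x_4,\ [x_2,x_2]=x_4,\ [x_3,x_3]=x_4$. $\mathcal{A}_5$: $[x_1,x_2]=x_4,\ [x_2,x_1]=cx_4,\ [x_3,x_3]=x_4$, for some $c\in\mathbb{C}\setminus\{1,-1\}$. $\mathcal{A}_6$: $[x_1,x_1]=x_4,\ [x_2,x_2]=x_4,\ [x_3,x_3]=x_4$. $\mathcal{A}_7$: $[x_1,x_1]=x_2,\ [x_1,x_2]=x_3,\ [x_1,x_3]=x_4$. $\mathcal{A}_8$: $[x_1,x_1]=x_4,\ [x_1,x_2]=x_3=-[x_2,x_1]$. $\mathcal{A}_9$: $[x_1,x_1]=x_4,\ [x_1,x_2]=x_3=-[x_2,x_1],\ [x_2,x_2]=x_4$. $\mathcal{A}_{10}$: $[x_1,x_1]=x_4,\ [x_1,x_2]=x_3=-[x_2,x_1],\ [x_1,x_3]=x_4=-[x_3,x_1]$.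 $\mathcal{A}_{11}$: $[x_1,x_2]=x_3=-[x_2,x_1],\ [x_2,x_2]=x_4,\ [x_1,x_3]=x_4=-[x_3,x_1]$. $\mathcal{A}_{12}$: $[x_1,x_1]=x_4,\ [x_1,x_2]=x_3,\ [x_2,x_1]=-x_3+x_4,\ [x_1,x_3]=x_4=-[x_3,x_1]$. $\mathcal{A}_{13}$: $[x_2,x_2]=x_4,\ [x_1,x_2]=x_3,\ [x_2,x_1]=-x_3+x_4,\ [x_1,x_3]=x_4=-[x_3,x_1]$. $\mathcal{A}_{14}$: $[x_1,x_1]=x_3,\ [x_1,x_2]=x_4$. $\mathcal{A}_{15}$: $[x_1,x_1]=x_3,\ [x_2,x_1]=x_4$. $\mathcal{A}_{16}$: $[x_1,x_2]=x_4,\ [x_2,x_1]=x_3,\ [x_2,x_2]=-x_3$. $\mathcal{A}_{17}$: $[x_1,x_1]=x_3,\ [x_1,x_2]=x_4,\ [x_2,x_1]=\alpha x_4$, for some $\alpha\in\mathbb{C}\setminus\{-1,0\}$. $\mathcal{A}_{18}$: $[x_1,x_1]=x_3,\ [x_2,x_1]=x_4,\ [x_1,x_2]=\alpha x_3,\ [x_2,x_2]=-x_4$, for some $\alpha\in\mathbb{C}\setminus\{-1\}$. $\mathcal{A}_{19}$: $[x_1,x_1]=x_3,\ [x_1,x_2]=x_3,\ [x_2,x_1]=x_3+x_4,\ [x_2,x_2]=x_4$. $\mathcal{A}_{20}$: $[x_1,x_2]=x_3,\ [x_1,x_3]=x_4$. $\mathcal{A}_{21}$: $[x_1,x_2]=x_3,\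 [x_2,x_2]=x_4,\ [x_1,x_3]=x_4$. $\mathcal{A}_{22}$: $[x_1,x_2]=x_3,\ [x_2,x_1]=x_4,\ [x_1,x_3]=x_4$. $\mathcal{A}_{23}$: $[x_1,x_2]=x_3,\ [x_2,x_1]=x_4,\ [x_2,x_2]=x_4,\ [x_1,x_3]=x_4$. $\mathcal{A}_{24}$: $[x_1,x_1]=x_3,\ [x_2,x_1]=x_4,\ [x_1,x_3]=x_4$. $\mathcal{A}_{25}$: $[x_1,x_1]=x_3,\ [x_2,x_2]=x_4,\ [x_1,x_3]=x_4$. Moreover, these classes are pairwise nonisomorphic: if $i\neq j$, no algebra of type $\mathcal{A}_i$ is isomorphic to an algebra of type $\mathcal{A}_j$ (for any admissible parameter values).
   Context: All algebras are over $\mathbb{C}$. A (left) Leibniz algebra is a $\mathbb{C}$-vector space $A$ with a bilinear product $[\,,\,]:A\times A\to A$ such that every left multiplication operator is a derivation, i.e. $[a,[b,c]]=[[a,b],c]+[b,[a,c]]$ for all $a,b,c\in A$. Put $A^1=A$ and $A^i=[A,A^{i-1}]$ (the span of the products) for $i\ge 2$; $A$ is nilpotent if $A^{c+1}=0$ for some positive integer $c$. $\mathrm{Leib}(A)=\mathrm{span}\{[a,a]\mid a\in A\}$; $A$ is a Lie algebra if and only if $\mathrm{Leib}(A)=0$, and ''non-Lie'' means $\mathrm{Leib}(A)\ne 0$. $A$ is split if it is a direct sum of two nontrivial ideals, and non-split otherwise. Products of basis elements not listed are zero. *)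

(* Defs.v *)
From HB Require Import structures.
From mathcomp Require Import all_boot all_order all_algebra.
From mathcomp Require Import sesquilinear.
From mathcomp Require Import boolp classical_sets.

Set Implicit Arguments.
Unset Strict Implicit.
Unset Printing Implicit Defensive.

Import GRing.Theory.

Local Open Scope classical_set_scope.
Local Open Scope ring_scope.

(* Finite-dimensional left Leibniz algebras. *)
Record leibnizAlg (F : fieldType) := LeibnizAlg {
  leibniz_sort :> vectType F;
  brk : {bilinear leibniz_sort -> leibniz_sort -> leibniz_sort};
  brkJ : forall a b c : leibniz_sort,
    brk a (brk b c) = brk (brk a b) c + brk b (brk a c) }.

(* Linear span of an arbitrary, possibly infinite, set of vectors. *)
Definition lspan (F : fieldType) (V : vectType F) (S : set V) : set V :=
  [set v | exists2 s : seq V, (forall x, x \in s -> S x) & v \in <<s>>%VS].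

Section LeibnizTheory.
Variables (F : fieldType) (A : leibnizAlg F).

(* Starts at [lcs 1 = A]; the value at 0 is a dummy. *)
Fixpoint lcs (i : nat) : set A :=
  match i with
  | 0 | 1 => setT
  | j.+1 => lspan [set z | exists a b : A, lcs j b /\ z = brk A a b]
  end.

Definition nilpotent_leibniz : Prop :=
  exists c : nat, (0 < c)%N /\ lcs c.+1 = [set 0].

Definition Leib : set A := lspan [set z | exists a : A, z = brk A a a].

Definition non_lie : Prop := Leib <> [set 0].

Definition leibniz_ideal (I : {vspace A}) : Prop :=
  forall a x : A, x \in I -> brk A a x \in I /\ brk A x a \in I.

Definition split_leibniz : Prop :=
  exists I J : {vspace A},
    [/\ leibniz_ideal I, leibniz_ideal J, I != 0%VS, J != 0%VS
      & (I + J)%VS = fullv /\ directv (I + J)].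

End LeibnizTheory.

Definition leibniz_iso (F : fieldType) (A B : leibnizAlg F) : Prop :=
  exists f : {linear A -> B},
    bijective f /\ forall a b : A, f (brk A a b) = brk B (f a) (f b).

(* [leibniz_product k c x1 x2 x3 x4 i j] is the product [x_i, x_j] prescribed in
   the k-th class; c is the parameter of classes 5, 17 and 18 (called alpha in
   the last two) and is ignored by the other classes. *)
Definition leibniz_product (F : fieldType) (V : lmodType F) (k : nat) (c : F)
    (x1 x2 x3 x4 : V) (i j : nat) : V :=
  match k with
  | 1 => match i, j with
         | 1, 3 => x4 | 3, 2 => x4 | _, _ => 0 end
  | 2 => match i, j with
         | 1, 3 => x4 | 2, 2 => x4 | 2, 3 => x4 | 3, 1 => x4 | 3, 2 => - x4
         | _, _ => 0 end
  | 3 => match i, j with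
         | 1, 2 => x4 | 2, 1 => - x4 | 3, 3 => x4 | _, _ => 0 end
  | 4 => match i, j with
         | 1, 2 => x4 | 2, 1 => - x4 | 2, 2 => x4 | 3, 3 => x4
         | _, _ => 0 end
  | 5 => match i, j with
         | 1, 2 => x4 | 2, 1 => c *: x4 | 3, 3 => x4 | _, _ => 0 end
  | 6 => match i, j with
         | 1, 1 => x4 | 2, 2 => x4 | 3, 3 => x4 | _, _ => 0 end
  | 7 => match i, j with
         | 1, 1 => x2 | 1, 2 => x3 | 1, 3 => x4 | _, _ => 0 end
  | 8 => match i, j with
         | 1, 1 => x4 | 1, 2 => x3 | 2, 1 => - x3 | _, _ => 0 end
  | 9 => match i, j with
         | 1, 1 => x4 | 1, 2 => x3 | 2, 1 => - x3 | 2, 2 => x4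
         | _, _ => 0 end
  | 10 => match i, j with
          | 1, 1 => x4 | 1, 2 => x3 | 2, 1 => - x3 | 1, 3 => x4 | 3, 1 => - x4
          | _, _ => 0 end
  | 11 => match i, j with
          | 1, 2 => x3 | 2, 1 => - x3 | 2, 2 => x4 | 1, 3 => x4 | 3, 1 => - x4
          | _, _ => 0 end
  | 12 => match i, j with
          | 1, 1 => x4 | 1, 2 => x3 | 2, 1 => - x3 + x4
          | 1, 3 => x4 | 3, 1 => - x4 | _, _ => 0 end
  | 13 => match i, j with
          | 2, 2 => x4 | 1, 2 => x3 | 2, 1 => - x3 + x4
          | 1, 3 => x4 | 3, 1 => - x4 | _, _ => 0 end
  | 14 => match i, j with
          | 1, 1 => x3 | 1, 2 => x4 | _, _ => 0 end
  | 15 => match i, j with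
          | 1, 1 => x3 | 2, 1 => x4 | _, _ => 0 end
  | 16 => match i, j with
          | 1, 2 => x4 | 2, 1 => x3 | 2, 2 => - x3 | _, _ => 0 end
  | 17 => match i, j with
          | 1, 1 => x3 | 1, 2 => x4 | 2, 1 => c *: x4 | _, _ => 0 end
  | 18 => match i, j with
          | 1, 1 => x3 | 2, 1 => x4 | 1, 2 => c *: x3 | 2, 2 => - x4
          | _, _ => 0 end
  | 19 => match i, j with
          | 1, 1 => x3 | 1, 2 => x3 | 2, 1 => x3 + x4 | 2, 2 => x4
          | _, _ => 0 end
  | 20 => match i, j with
          | 1, 2 => x3 | 1, 3 => x4 | _, _ => 0 end
  | 21 => match i, j with
          | 1, 2 => x3 | 2, 2 => x4 | 1, 3 => x4 | _, _ => 0 end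
  | 22 => match i, j with
          | 1, 2 => x3 | 2, 1 => x4 | 1, 3 => x4 | _, _ => 0 end
  | 23 => match i, j with
          | 1, 2 => x3 | 2, 1 => x4 | 2, 2 => x4 | 1, 3 => x4
          | _, _ => 0 end
  | 24 => match i, j with
          | 1, 1 => x3 | 2, 1 => x4 | 1, 3 => x4 | _, _ => 0 end
  | 25 => match i, j with
          | 1, 1 => x3 | 2, 2 => x4 | 1, 3 => x4 | _, _ => 0 end
  | _ => 0
  end.

Definition admissible (F : fieldType) (k : nat) (c : F) : Prop :=
  match k with
  | 5 => c <> 1 /\ c <> -1
  | 17 => c <> -1 /\ c <> 0
  | 18 => c <> -1
  | _ => True
  end.

(* The basis is 0-indexed: [x`_i] is the vector x_(i+1). *)
Definition of_class (F : fieldType) (k : nat) (B : leibnizAlg F) : Prop :=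
  exists (c : F) (x : 4.-tuple B),
    [/\ admissible k c, basis_of fullv x
      & forall i j : 'I_4, brk B x`_i x`_j =
          leibniz_product k c x`_0 x`_1 x`_2 x`_3 i.+1 j.+1].

(* Main.v *)
Require Import Defs.
From mathcomp Require Import all_boot all_order all_algebra.
From mathcomp Require Import sesquilinear boolp classical_sets.
From mathcomp Require Import reals complex.
From mathcomp Require Import ring zify.
Set Implicit Arguments.
Unset Strict Implicit.
Unset Printing Implicit Defensive.
Import GRing.Theory Num.Theory.
Local Open Scope ring_scope.

(** Everything is governed by the lower central series, written [gam] below,
    with [gam 1] the derived algebra. The argument takes place over a
    quadratically closed field of characteristic different from two.

    The algebra is generated by any family that spans modulo the derived
    algebra ([generating_subalgebra]). Hence to put an algebra in a given class
    it suffices to exhibit generators that obey the table ([of_class_generated]).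
    Non-splitness enters only through [central_generator] and
    [orthogonal_pair_split]. The dimension of the derived algebra separates the
    following situations ([classification]).

    - Dimension three: there is one generator, and its left powers form the
      null-filiform table ([one_generator]).
    - Dimension one: the product is a bilinear form on a three-space without
      two-sided radical, to be classified up to congruence and scaling
      ([derived_line], [classify_form]). If its antisymmetric part vanishes, the
      form is diagonalised. Otherwise that part has a radical line, which splits
      off orthogonally when it is anisotropic, leaving a form on a plane, and
      which lies in a hyperbolic plane when it is isotropic
      ([not_symmetric]).
    - Dimension two, with all threefold products zero: one has a bilinear map
      from a plane onto a plane. The three coefficients of the quadratic map
      a |-> [a,a] are linearly dependent, which provides either an isotropic
      generator or two generators u, v with [u,v] + [v,u] = 0 ([class_two]). In
      the second case, generically [u,v] = p[u,u] + q[v,v]. The algebra splits if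
      p = q = 0, and otherwise pq is its modulus: with s^2 = 1 + 4pq, the case
      s = 0 is exceptional, and else s^2 - 1 is the parameter of the class.
    - Dimension two, with threefold products spanning a line: one can choose
      generators u, v and x3 in the derived algebra with [u,x3] spanning that
      line and [v,x3] = 0. The Leibniz identity leaves three shapes for the
      remaining products ([left_null_chain], [square_chain], [skew_chain]).

    For the second half of the statement, the number of a class is computed from
    the product alone by a decision tree of isomorphism invariants
    ([classify], [classifyP]), and classes are transported by isomorphisms
    ([of_class_iso]). *)

(** * Linear identities in a module *)

Section LinearTerms.
Variables (R : pzRingType) (V : lmodType R).

(** Syntax of linear combinations, for a decision procedure by reflection: two
    combinations of the same atoms agree as soon as their coefficients do. *)
Inductive lterm :=
  | LAtom of nat
  | LZero
  | LAdd of lterm & lterm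
  | LOpp of lterm
  | LScale of R & lterm.

Fixpoint leval (e : seq V) (t : lterm) : V :=
  match t with
  | LAtom i => nth 0 e i
  | LZero => 0
  | LAdd t1 t2 => leval e t1 + leval e t2
  | LOpp t1 => - leval e t1
  | LScale c t1 => c *: leval e t1
  end.

Fixpoint lcoef (i : nat) (t : lterm) : R :=
  match t with
  | LAtom j => if eqn j i then 1 else 0
  | LZero => 0
  | LAdd t1 t2 => lcoef i t1 + lcoef i t2
  | LOpp t1 => - lcoef i t1
  | LScale c t1 => c * lcoef i t1
  end.

Lemma leval_coef e t : leval e t = \sum_(i < size e) lcoef i t *: e`_i.
Proof.
elim: t => [j||t1 IH1 t2 IH2|t1 IH1|c t1 IH1] /=.
- rewrite eqnE; case: (ltnP j (size e)) => hj.
    rewrite (bigD1 (Ordinal hj)) //= eqxx scale1r big1 ?addr0 // => i.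
    by rewrite -val_eqE /= eq_sym => /negPf ->; rewrite scale0r.
  rewrite nth_default // big1 // => i _; rewrite gtn_eqF ?scale0r //.
  exact: leq_trans (ltn_ord i) hj.
- by rewrite big1 // => i _; rewrite scale0r.
- by rewrite IH1 IH2 -big_split; apply: eq_bigr => i _; rewrite scalerDl.
- by rewrite IH1 -sumrN; apply: eq_bigr => i _; rewrite scaleNr.
- by rewrite IH1 scaler_sumr; apply: eq_bigr => i _; rewrite scalerA.
Qed.

Fixpoint same_coefs (n : nat) (t1 t2 : lterm) : Prop :=
  match n with
  | 0 => True
  | n'.+1 => same_coefs n' t1 t2 /\ lcoef n' t1 = lcoef n' t2
  end.

Lemma leval_eq e t1 t2 : same_coefs (size e) t1 t2 -> leval e t1 = leval e t2.
Proof.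
move=> h; rewrite !leval_coef; apply: eq_bigr => i _; congr (_ *: _).
move: h (ltn_ord i); move: (size e) (i : nat) => n {}i.
elim: n => //= n IH [h1 h2].
by rewrite ltnS leq_eqVlt => /orP[/eqP ->|]; [|apply: IH].
Qed.

End LinearTerms.

Ltac lmem x l :=
  lazymatch l with
  | nil => constr:(false)
  | cons x _ => constr:(true)
  | cons _ ?l' => lmem x l'
  end.

Ltac latoms V t l :=
  lazymatch t with
  | @GRing.add _ ?a ?b => let l := latoms V a l in latoms V b l
  | @GRing.opp _ ?a => latoms V a l
  | @GRing.scale _ _ _ ?a => latoms V a l
  | @GRing.zero _ => l
  | _ => match lmem t l with true => l | false => constr:(@cons V t l) end
  end.

Ltac lindex x l :=
  lazymatch l with
  | cons x _ => constr:(0%N)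
  | cons _ ?l' => let n := lindex x l' in constr:(S n)
  end.

Ltac lreify R t l :=
  lazymatch t with
  | @GRing.add _ ?a ?b =>
      let a' := lreify R a l in let b' := lreify R b l in constr:(@LAdd R a' b')
  | @GRing.opp _ ?a => let a' := lreify R a l in constr:(@LOpp R a')
  | @GRing.scale _ _ ?c ?a => let a' := lreify R a l in constr:(@LScale R c a')
  | @GRing.zero _ => constr:(@LZero R)
  | _ => let n := lindex t l in constr:(@LAtom R n)
  end.

Ltac lmod_with R V :=
  lazymatch goal with
  | |- @eq ?T ?u ?v =>
    let l := latoms T u (@nil T) in
    let l := latoms T v l in
    let u' := lreify R u l in
    let v' := lreify R v l in
    refine (@leval_eq R V l u' v' _);
    cbn [same_coefs lcoef size eqn];
    repeat (split; [|]); [exact I|..]; try ring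
  end.

(* [lmod] reduces an identity between linear combinations of vectors to the
   equality of the coefficients, and leaves those that [ring] cannot prove. *)
Ltac lmod :=
  lazymatch goal with
  | |- @eq ?T _ _ =>
    match T with context [@leibniz_sort ?F ?A] => lmod_with F (@leibniz_sort F A) end
  end.

(** * Products and the lower central series *)

Notation "a ** b" := (brk _ a b) (at level 40, left associativity) : ring_scope.

Section Series.
Variables (F : fieldType) (A : leibnizAlg F).
Implicit Types (a b c u v w : A) (U W S : {vspace A}).

Lemma brkDl a b c : (a + b) ** c = a ** c + b ** c. Proof. exact: linearDl. Qed.
Lemma brkDr a b c : a ** (b + c) = a ** b + a ** c. Proof. exact: linearDr. Qed.
Lemma brkNl a b : (- a) ** b = - (a ** b). Proof. exact: linearNl. Qed.
Lemma brkNr a b : a ** (- b) = - (a ** b). Proof. exact: linearNr. Qed.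
Lemma brkZl k a b : (k *: a) ** b = k *: (a ** b). Proof. exact: linearZl_LR. Qed.
Lemma brkZr k a b : a ** (k *: b) = k *: (a ** b). Proof. exact: linearZr_LR. Qed.
Lemma brk0l a : 0 ** a = 0 :> A. Proof. exact: linear0l. Qed.
Lemma brk0r a : a ** 0 = 0 :> A. Proof. exact: linear0r. Qed.

Definition brkE := (brkDl, brkDr, brkNl, brkNr, brkZl, brkZr, brk0l, brk0r).

(** Left multiplication by a square vanishes: the Leibniz identity on a, a, b
    reads [a,[a,b]] = [[a,a],b] + [a,[a,b]]. *)
Lemma brk_square a b : (a ** a) ** b = 0.
Proof. by apply: (addIr (a ** (a ** b))); rewrite -brkJ add0r. Qed.

Lemma brk_left a b c : (a ** b) ** c = a ** (b ** c) - b ** (a ** c).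
Proof. by rewrite [a ** (b ** c)]brkJ addrK. Qed.

Lemma brk_span W (X Y : seq A) :
  (forall x y, x \in X -> y \in Y -> x ** y \in W) ->
  forall a b, a \in <<X>>%VS -> b \in <<Y>>%VS -> a ** b \in W.
Proof.
move=> h a b aX bY.
have hx x : x \in X -> x ** b \in W.
  move=> xX; have /subvP/(_ b bY) : (<<Y>> <= linfun (brk A x) @^-1: W)%VS.
    by apply/span_subvP => y yY; rewrite -memv_preim lfunE /= h.
  by rewrite -memv_preim lfunE.
have /subvP/(_ a aX) : (<<X>> <= linfun (applyr (brk A) b) @^-1: W)%VS.
  by apply/span_subvP => x xX; rewrite -memv_preim lfunE /= hx.
by rewrite -memv_preim lfunE.
Qed.

Definition brkv U : {vspace A} :=
  <<[seq x ** y | x <- vbasis {:A}, y <- vbasis U]>>%VS.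

Lemma mem_brkv U a b : b \in U -> a ** b \in brkv U.
Proof.
move=> bU; apply: (@brk_span _ (vbasis {:A}) (vbasis U)).
- by move=> x y hx hy; apply/memv_span/allpairsP; exists (x, y).
- by rewrite (span_basis (vbasisP _)) memvf.
- by rewrite (span_basis (vbasisP _)).
Qed.

Lemma brkv_sub U W : (forall a b, b \in U -> a ** b \in W) -> (brkv U <= W)%VS.
Proof.
move=> h; apply/span_subvP => z /allpairsP[[x y] [/= _ hy ->]].
exact/h/vbasis_mem.
Qed.

Lemma brkvS U W : (U <= W)%VS -> (brkv U <= brkv W)%VS.
Proof. by move=> /subvP UW; apply: brkv_sub => a b /UW; apply: mem_brkv. Qed.

(** [gam j] is the term of index j + 1 of the lower central series. *)
Fixpoint gam (j : nat) : {vspace A} :=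
  match j with 0 => {:A}%VS | j'.+1 => brkv (gam j') end.

Lemma lcs_gam j b : lcs j.+1 b <-> b \in gam j.
Proof.
elim: j b => [|j IH] b; first by rewrite memvf; split.
change (lcs j.+2 b) with
  (lspan [set z | exists a c : A, lcs j.+1 c /\ z = a ** c]%classic b).
split=> [[s hs]|bG].
  apply/subvP; apply/span_subvP => x /hs [a [c [/IH hc ->]]].
  exact: mem_brkv.
exists [seq x ** y | x <- vbasis {:A}, y <- vbasis (gam j)] => //.
move=> z /allpairsP[[x y] [/= _ hy ->]]; exists x, y; split=> //.
exact/IH/vbasis_mem.
Qed.

Lemma gamS j : (gam j.+1 <= gam j)%VS.
Proof. by elim: j => [|j IH] /=; [apply: subvf | apply: brkvS]. Qed.

Lemma gam_anti i j : (i <= j)%N -> (gam j <= gam i)%VS.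
Proof.
move=> /subnK <-; elim: (j - i)%N => [|k IH]; first exact: subvv.
exact: subv_trans (gamS _) IH.
Qed.

(** By induction on the depth of the left factor, because left multiplication
    by [x,y] is the commutator of the left multiplications by x and y. *)
Lemma brk_gam i j a b : a \in gam i -> b \in gam j -> a ** b \in gam (i + j).+1.
Proof.
elim: i j a b => [|i IH] j a b aG bG; first exact: mem_brkv.
have /subvP/(_ a aG) :
    (gam i.+1 <= linfun (applyr (brk A) b) @^-1: gam (i.+1 + j).+1)%VS.
  apply: brkv_sub => x y yG; rewrite -memv_preim lfunE /= /applyr_head brk_left.
  rewrite rpredB //; first exact/mem_brkv/IH.
  by have := IH j.+1 y (x ** b) yG (mem_brkv x bG); rewrite addnS.
by rewrite -memv_preim lfunE.
Qed.

Lemma gam1E a b : a ** b \in gam 1.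
Proof. exact/mem_brkv/memvf. Qed.

Hypothesis nilA : nilpotent_leibniz A.

Lemma gam_nil : exists n, gam n = 0%VS.
Proof.
case: nilA => n [_ hc]; exists n; apply/eqP; rewrite -subv0; apply/subvP => b.
by move=> /lcs_gam; rewrite hc memv0 => ->.
Qed.

(** A term equal to its successor would be repeated forever. *)
Lemma dim_gamS j : gam j != 0%VS -> (\dim (gam j.+1) < \dim (gam j))%N.
Proof.
apply: contraNltn => hd; have /eqP st : gam j.+1 == gam j by rewrite eqEdim gamS.
have {}st k : gam (k + j) = gam j.
  by elim: k => //= k ->; rewrite -[RHS]st.
have [c hc] := gam_nil; rewrite -(st c) -subv0 -hc.
by rewrite gam_anti // leq_addr.
Qed.

Lemma gam_eq0 j : (\dim {:A} <= j)%N -> gam j = 0%VS.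
Proof.
move=> dj; suff h k : (\dim (gam k) <= \dim {:A} - k)%N.
  by apply/eqP; rewrite -dimv_eq0 -leqn0 (leq_trans (h j)) // leqn0 subn_eq0.
elim: k => [|k IH]; first by rewrite subn0.
have [g0|gn0] := eqVneq (gam k) 0%VS.
  by rewrite (leq_trans (dimvS (gamS k))) // g0 dimv0.
by have := dim_gamS gn0; lia.
Qed.

(** By induction, each term of the lower central series lies in the sum of S
    and the next term; nilpotency ends the descent. *)
Lemma generating_subalgebra S :
    (forall a b, a \in S -> b \in S -> a ** b \in S) ->
  (S + gam 1 = {:A})%VS -> S = {:A}%VS.
Proof.
move=> Scl SA.
have step j : (gam j <= S + gam j.+1)%VS.
  elim: j => [|j IH]; first by rewrite SA subvf.
  apply: brkv_sub => a b bG.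
  have /memv_addP[b1 b1S [b2 b2G eb]] := subvP IH b bG.
  have /memv_addP[a1 a1S [a2 a2G ea]] : a \in (S + gam 1)%VS by rewrite SA memvf.
  have b1G : b1 \in gam j.
    by rewrite -(addrK b2 b1) -eb rpredB // (subvP (gamS _)).
  rewrite eb brkDr {1}ea brkDl -addrA memv_add ?Scl //.
  by apply: rpredD; [apply: (@brk_gam 1 j) | apply: mem_brkv].
have sub j : (S + gam j = {:A})%VS.
  elim: j => [|j IH]; first exact: addvf.
  apply/eqP; rewrite eqEsubv subvf /= -IH subv_add addvSl /=; exact: step.
by have [c hc] := gam_nil; rewrite -[RHS](sub c) hc addv0.
Qed.

End Series.

Section Classes.
Variables (F : fieldType) (A : leibnizAlg F).
Implicit Types (x : A).

Hypotheses (dimA : \dim {:A} = 4%N) (nilA : nilpotent_leibniz A).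

Lemma leibniz_product_mem (S : {vspace A}) k c x1 x2 x3 x4 i j :
    x1 \in S -> x2 \in S -> x3 \in S -> x4 \in S ->
  leibniz_product k c x1 x2 x3 x4 i j \in S.
Proof.
move=> h1 h2 h3 h4.
do 26?[case: k => [|k] /=; try exact: mem0v];
  do 4?[case: i => [|i] /=; try exact: mem0v];
  do 4?[case: j => [|j] /=; try exact: mem0v];
  by rewrite ?rpredD ?rpredN ?rpredZ ?mem0v.
Qed.

(** Linear independence comes for free: the span of the four vectors is closed
    under products by the table, so it is the whole four-dimensional
    algebra. *)
Lemma of_class_generated k c x1 x2 x3 x4 :
    admissible k c ->
    (<<[:: x1; x2; x3; x4]>> + gam A 1 = {:A})%VS ->
    (forall i j : 'I_4, brk A [:: x1; x2; x3; x4]`_i [:: x1; x2; x3; x4]`_j =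
       leibniz_product k c x1 x2 x3 x4 i.+1 j.+1) ->
  of_class k A.
Proof.
move=> adm gen tab; exists c, [tuple x1; x2; x3; x4]; split=> //.
rewrite basisEdim /= dimA leqnn andbT.
rewrite (@generating_subalgebra _ _ nilA <<[:: x1; x2; x3; x4]>>%VS) //.
apply: brk_span => x y /(nthP 0)[i hi <-] /(nthP 0)[j hj <-].
rewrite (tab (Ordinal hi) (Ordinal hj)).
by apply: leibniz_product_mem; apply: memv_span; rewrite !inE eqxx ?orbT.
Qed.

End Classes.

(** * Consequences of being non-split and non-Lie *)

Section Splitting.
Variables (F : fieldType) (A : leibnizAlg F).
Implicit Types (a b u v w : A).

Lemma non_lie_square : non_lie A -> exists a, a ** a != 0.
Proof.
move=> nl; apply: contrapT => h; apply: nl.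
have sq a : a ** a = 0 by apply/eqP/negPn/negP => ha; apply: h; exists a.
rewrite eqEsubset; split=> v.
  move=> [s hs vs]; suff /subvP/(_ v vs) : (<<s>> <= 0)%VS by rewrite memv0 => /eqP.
  by apply/span_subvP => x /hs[a ->]; rewrite sq mem0v.
by move=> ->; exists [::] => //; rewrite mem0v.
Qed.

(** A vector outside the derived algebra that kills everything on both sides
    spans a direct factor: any hyperplane that contains the derived algebra is
    an ideal. *)
Lemma central_split v :
    (1 < \dim {:A})%N -> v \notin gam A 1 ->
    (forall a, a ** v = 0 /\ v ** a = 0) ->
  split_leibniz A.
Proof.
move=> dimA vG cv; pose U := (<[v]> + gam A 1)%VS; pose J := (gam A 1 + U^C)%VS.
have v0 : v != 0 by apply: contraNneq vG => ->; apply: mem0v.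
have IJ : (<[v]> + J = {:A})%VS by rewrite addvA addv_complf.
exists <[v]>%VS, J; split.
- by move=> a x /vlineP[k ->]; rewrite !brkE; case: (cv a) => -> ->;
    rewrite scaler0 mem0v.
- move=> a x _; split; apply: (subvP (addvSl _ _)); exact: gam1E.
- by rewrite -dimv_eq0 dim_vline v0.
- apply: contraTneq dimA => J0.
  by rewrite -IJ J0 addv0 dim_vline v0.
split=> //; apply/directv_addP/eqP; rewrite -subv0; apply/subvP => w.
move=> /memv_capP[/vlineP[k ->] /memv_addP[g gG [c cC e]]].
have cU : c \in U.
  have -> : c = k *: v + - g by rewrite e; lmod.
  by rewrite memv_add ?rpredN ?rpredZ ?memv_line.
have /eqP c0 : c == 0 by rewrite -memv0 -(capv_compl U) memv_cap cU.
rewrite memv0; apply: contraNT vG; rewrite scaler_eq0 (negPf v0) orbF => k0.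
by rewrite -(scale1r v) -(mulVf k0) -scalerA e c0 addr0 rpredZ.
Qed.

Lemma orthogonal_pair_split u v :
    \dim {:A} = 4%N -> (<<[:: u; u ** u]>> + <<[:: v; v ** v]>> = {:A})%VS ->
    (forall a b c, a ** (b ** c) = 0 /\ (b ** c) ** a = 0) ->
    u ** v = 0 -> v ** u = 0 ->
  split_leibniz A.
Proof.
move=> dimA gen A3 uv vu.
have ideal x y : (<<[:: x; x ** x]>> + <<[:: y; y ** y]>> = {:A})%VS ->
    x ** y = 0 -> y ** x = 0 -> leibniz_ideal <<[:: x; x ** x]>>%VS.
  move=> g xy yx a z zI.
  have aA : a \in <<[:: x; x ** x; y; y ** y]>>%VS.
    by rewrite (@span_cat _ _ [:: x; x ** x] [:: y; y ** y]) g memvf.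
  have xx : x ** x \in <<[:: x; x ** x]>>%VS by rewrite memv_span // !inE eqxx orbT.
  split; [move: aA zI | move: zI aA]; apply: brk_span => b c; rewrite !inE.
    move=> /or4P[]/eqP-> /orP[]/eqP->;
      rewrite ?yx ?(A3 _ _ _).1 ?(A3 _ _ _).2 ?mem0v //.
  move=> /orP[]/eqP-> /or4P[]/eqP->; rewrite ?xy ?(A3 _ _ _).1 ?(A3 _ _ _).2 ?mem0v //.
have d2 (x : A) : (\dim <<[:: x; x ** x]>> <= 2)%N := dim_span [:: x; x ** x].
have dd := dimv_sum_cap <<[:: u; u ** u]>>%VS <<[:: v; v ** v]>>%VS.
rewrite gen dimA in dd.
exists <<[:: u; u ** u]>>%VS, <<[:: v; v ** v]>>%VS; split.
- exact: ideal gen uv vu.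
- by apply: (ideal v u); rewrite // addvC.
- by rewrite -dimv_eq0; have := d2 u; have := d2 v; lia.
- by rewrite -dimv_eq0; have := d2 u; have := d2 v; lia.
split=> //; apply/directv_addP/eqP; rewrite -dimv_eq0.
by have := d2 u; have := d2 v; lia.
Qed.

End Splitting.

(** * Coordinates of products *)

Section Coordinates.
Variables (F : fieldType) (B : leibnizAlg F).

Definition lc (x1 x2 x3 x4 : B) (a1 a2 a3 a4 : F) : B :=
  a1 *: x1 + a2 *: x2 + a3 *: x3 + a4 *: x4.

(** The coefficient of the m-th basis vector in the (i, j) entry of a table,
    obtained by evaluating the table at the m-th coordinates of the basis. *)
Definition tcoef k (c : F) (m i j : nat) : F :=
  @leibniz_product F F^o k c (m == 1)%:R (m == 2)%:R (m == 3)%:R (m == 4)%:R i j.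

(** The m-th coordinate of a product of two vectors given by coordinates. *)
Definition mcoef k c m (a1 a2 a3 a4 b1 b2 b3 b4 : F) : F :=
  a1 * (b1 * tcoef k c m 1 1 + b2 * tcoef k c m 1 2 + b3 * tcoef k c m 1 3 + b4 * tcoef k c m 1 4)
  + a2 * (b1 * tcoef k c m 2 1 + b2 * tcoef k c m 2 2 + b3 * tcoef k c m 2 3 + b4 * tcoef k c m 2 4)
  + a3 * (b1 * tcoef k c m 3 1 + b2 * tcoef k c m 3 2 + b3 * tcoef k c m 3 3 + b4 * tcoef k c m 3 4)
  + a4 * (b1 * tcoef k c m 4 1 + b2 * tcoef k c m 4 2 + b3 * tcoef k c m 4 3 + b4 * tcoef k c m 4 4).

Lemma regular_scaleE (a b : F) : a *: (b : F^o) = a * b.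
Proof. by []. Qed.

Lemma leibniz_productE k c (x1 x2 x3 x4 : B) i j :
  leibniz_product k c x1 x2 x3 x4 i j =
  lc x1 x2 x3 x4 (tcoef k c 1 i j) (tcoef k c 2 i j) (tcoef k c 3 i j) (tcoef k c 4 i j).
Proof.
have z0 : 0 = lc x1 x2 x3 x4 0 0 0 0 by rewrite /lc; lmod.
rewrite /tcoef.
do 26?[case: k => [|k] /=; try exact: z0];
  do 4?[case: i => [|i] /=; try exact: z0];
  do 4?[case: j => [|j] /=; try exact: z0];
  rewrite /lc; lmod; rewrite !regular_scaleE; ring.
Qed.

Lemma lcD (x1 x2 x3 x4 : B) a1 a2 a3 a4 b1 b2 b3 b4 :
  lc x1 x2 x3 x4 a1 a2 a3 a4 + lc x1 x2 x3 x4 b1 b2 b3 b4 =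
  lc x1 x2 x3 x4 (a1 + b1) (a2 + b2) (a3 + b3) (a4 + b4).
Proof. by rewrite /lc; lmod. Qed.

Lemma lcN (x1 x2 x3 x4 : B) a1 a2 a3 a4 :
  - lc x1 x2 x3 x4 a1 a2 a3 a4 = lc x1 x2 x3 x4 (- a1) (- a2) (- a3) (- a4).
Proof. by rewrite /lc; lmod. Qed.

Lemma lcZ (x1 x2 x3 x4 : B) k a1 a2 a3 a4 :
  k *: lc x1 x2 x3 x4 a1 a2 a3 a4 = lc x1 x2 x3 x4 (k * a1) (k * a2) (k * a3) (k * a4).
Proof. by rewrite /lc; lmod. Qed.

(** A basis adapted to class k, in the form used for computations: unique
    coordinates, and the product as an explicit bilinear expression in them. *)
Record frame k c (x1 x2 x3 x4 : B) : Prop := Frame {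
  frame_adm : admissible k c;
  frame_span : forall v : B, exists a1 a2 a3 a4, v = lc x1 x2 x3 x4 a1 a2 a3 a4;
  frame_lc0 : forall a1 a2 a3 a4, lc x1 x2 x3 x4 a1 a2 a3 a4 = 0 <->
    [/\ a1 = 0, a2 = 0, a3 = 0 & a4 = 0];
  frame_mul : forall a1 a2 a3 a4 b1 b2 b3 b4,
    lc x1 x2 x3 x4 a1 a2 a3 a4 ** lc x1 x2 x3 x4 b1 b2 b3 b4 =
    lc x1 x2 x3 x4 (mcoef k c 1 a1 a2 a3 a4 b1 b2 b3 b4)
      (mcoef k c 2 a1 a2 a3 a4 b1 b2 b3 b4) (mcoef k c 3 a1 a2 a3 a4 b1 b2 b3 b4)
      (mcoef k c 4 a1 a2 a3 a4 b1 b2 b3 b4) }.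

Lemma of_class_frame k : of_class k B -> exists c x1 x2 x3 x4, frame k c x1 x2 x3 x4.
Proof.
case=> c [x [adm bas tab]].
exists c, x`_0, x`_1, x`_2, x`_3; split=> //.
- move=> v; have := coord_basis bas (memvf v).
  by rewrite !big_ord_recl big_ord0 addr0 !addrA => e; do 4!eexists; exact: e.
- move=> a1 a2 a3 a4; split; last by case=> -> -> -> ->; rewrite /lc; lmod.
  move=> e; have /freeP/(_ (fun i => [:: a1; a2; a3; a4]`_i)) := basis_free bas.
  rewrite !big_ord_recl big_ord0 addr0 !addrA => /(_ e) h.
  by split; [have := h 0 | have := h 1 | have := h 2 | have := h (inord 3);
    rewrite inordK].
- move=> a1 a2 a3 a4 b1 b2 b3 b4; rewrite {1 2}/lc !brkE.
  have t i j (hi : (i < 4)%N) (hj : (j < 4)%N) := tab (Ordinal hi) (Ordinal hj).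
  rewrite !(t 0%N) // !(t 1%N) // !(t 2) // !(t 3) //= !leibniz_productE.
  by rewrite !(lcZ, lcD) /mcoef; congr lc; ring.
Qed.

End Coordinates.

(** * Invariants that separate the classes *)

Section Invariants.
Variables (F : fieldType) (B : leibnizAlg F).
Implicit Types (a b d n u v w z : B).

Definition products_on_line := exists z, forall a b, exists s, a ** b = s *: z.
Definition squares_on_line := exists z, forall a, exists s, a ** a = s *: z.
Definition commuting := forall a b, a ** b = b ** a.
(** For squares with values in a line, this says that the quadratic form
    a |-> [a,a] has rank at most one. *)
Definition isotropic_closed :=
  forall a b, a ** a = 0 -> b ** b = 0 -> (a + b) ** (a + b) = 0.
(** For a form-valued product, the symmetric part of the form has a radical
    vector that is not in the radical of the form. *)
Definition anticommuting_vector :=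
  exists a b, a ** b <> 0 /\ forall d, a ** d + d ** a = 0.
Definition left_null_vector := exists a b, b ** a <> 0 /\ forall d, a ** d = 0.
(** For a form-valued product, the radical of the antisymmetric part is
    isotropic. *)
Definition commuting_isotropic := forall a, (forall d, a ** d = d ** a) -> a ** a = 0.
Definition triple_zero := forall a b d, a ** (b ** d) = 0.
Definition quadruple_zero := forall a b d n, a ** (b ** (d ** n)) = 0.
Definition left_triple_zero := forall a b d, (a ** b) ** d = 0.
Definition isotropic_left_null := forall a b, a ** a = 0 -> a ** b = 0.
Definition isotropic_right_null := forall a b, a ** a = 0 -> b ** a = 0.
Definition isotropic_null := isotropic_left_null /\ isotropic_right_null.
Definition isotropic_parallel :=
  forall a b, a ** a = 0 -> exists s, b ** a = s *: (a ** b).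

(** Apart from vectors that annihilate everything on the relevant side, all
    zero products [u,v] = 0 share the same line of right factors. For the two
    pencils of bilinear forms on a plane that this separates, it says that the
    determinant has a double root. *)
Definition single_zero_divisor := forall u v w u' v' w',
  u ** v = 0 -> w ** v <> 0 -> u' ** v' = 0 -> u' ** w' <> 0 -> u ** v' = 0.

(** When threefold products do not vanish, the vectors that kill the derived
    algebra from the left form a hyperplane, which is a canonical flag. The next
    invariants are values of the product along it. *)
Definition kills_derived a := forall b d, a ** (b ** d) = 0.
Definition killers_isotropic := forall a, kills_derived a -> a ** a = 0.
Definition killers_left_null := forall n a, kills_derived n -> n ** a = 0.
(** Products with a right factor in that hyperplane lie deeper in the series
    than general products. *)
Definition killers_deep := forall n a b, kills_derived n -> b ** (a ** n) = 0.
Definition killers_null_on_deep_squares := forall n a, kills_derived n ->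
  (forall b, b ** (a ** a) = 0) -> ~ kills_derived a -> n ** a = 0.

(** The first questions recover the dimensions of the terms of the lower
    central series: derived algebra of dimension one, vanishing of threefold
    products, vanishing of fourfold products. The others compare finer
    invariants inside each family. *)
Definition classify : nat :=
  if `[< products_on_line >] then
    if `[< commuting >] then 6
    else if `[< isotropic_closed >] then 3
    else if `[< anticommuting_vector >] then
      if `[< left_null_vector >] then 1 else 4
    else if `[< commuting_isotropic >] then 2 else 5
  else if `[< triple_zero >] then
    if `[< squares_on_line >] then
      if `[< isotropic_closed >] then 8 else 9
    else if `[< isotropic_null >] then
      if `[< single_zero_divisor >] then 19 else 18
    else if `[< isotropic_left_null >] then 14
    else if `[< isotropic_right_null >] then 15
    else if `[< isotropic_parallel >] then 17 else 16
  else if `[< quadruple_zero >] then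
    if `[< left_triple_zero >] then
      if `[< killers_deep >] then
        if `[< killers_isotropic >] then 24 else 25
      else if `[< killers_isotropic >] then
        if `[< killers_left_null >] then 20 else 22
      else if `[< killers_null_on_deep_squares >] then 21 else 23
    else if `[< killers_isotropic >] then
      if `[< isotropic_closed >] then 10 else 12
    else if `[< isotropic_closed >] then 11 else 13
  else 7.

End Invariants.

Lemma if_true (T : Type) (P : Prop) (x y : T) : P -> (if `[< P >] then x else y) = x.
Proof. by move=> /asboolT ->. Qed.

Lemma if_false (T : Type) (P : Prop) (x y : T) : ~ P -> (if `[< P >] then x else y) = y.
Proof. by move=> /asboolF ->. Qed.

Section Classification.
Variables (F : fieldType) (B : leibnizAlg F) (c : F) (x1 x2 x3 x4 : B).
Hypotheses (two_neq0 : 2 != 0 :> F) (sqrtF : forall a : F, exists b, b * b = a).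
Notation X := (lc x1 x2 x3 x4).
Notation frame k := (frame k c x1 x2 x3 x4).

Lemma lc_inj k a1 a2 a3 a4 b1 b2 b3 b4 : frame k ->
  X a1 a2 a3 a4 = X b1 b2 b3 b4 -> [/\ a1 = b1, a2 = b2, a3 = b3 & a4 = b4].
Proof.
move=> fr /eqP; rewrite -subr_eq0 lcN lcD => /eqP /(frame_lc0 fr).
by case=> /eqP e1 /eqP e2 /eqP e3 /eqP e4; split; apply/eqP; rewrite -subr_eq0.
Qed.

Lemma lc4_line a : X 0 0 0 a = a *: X 0 0 0 1.
Proof. by rewrite lcZ; congr lc; ring. Qed.

(** Two multiples of the same vector have proportional coordinates, so that
    two explicit products with a nonzero minor refute [products_on_line]. *)
Lemma products_minor k : frame k -> products_on_line B ->
  forall a b d n p1 p2 p3 p4 q1 q2 q3 q4,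
    a ** b = X p1 p2 p3 p4 -> d ** n = X q1 q2 q3 q4 ->
  p2 * q3 - p3 * q2 = 0 /\ p3 * q4 - p4 * q3 = 0.
Proof.
move=> fr [z hz] a b d n p1 p2 p3 p4 q1 q2 q3 q4.
have [z1 [z2 [z3 [z4 ez]]]] := frame_span fr z; rewrite ez in hz.
have [s ->] := hz a b; have [t ->] := hz d n; rewrite !lcZ.
by move=> /(lc_inj fr)[_ <- <- <-] /(lc_inj fr)[_ <- <- <-]; split; ring.
Qed.

Lemma squares_minor k : frame k -> squares_on_line B ->
  forall a b p1 p2 p3 p4 q1 q2 q3 q4,
    a ** a = X p1 p2 p3 p4 -> b ** b = X q1 q2 q3 q4 ->
  p3 * q4 - p4 * q3 = 0.
Proof.
move=> fr [z hz] a b p1 p2 p3 p4 q1 q2 q3 q4.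
have [z1 [z2 [z3 [z4 ez]]]] := frame_span fr z; rewrite ez in hz.
have [s ->] := hz a; have [t ->] := hz b; rewrite !lcZ.
by move=> /(lc_inj fr)[_ _ <- <-] /(lc_inj fr)[_ _ <- <-]; ring.
Qed.

Lemma sq0 (a : F) : a * a = 0 -> a = 0.
Proof. by move/eqP; rewrite mulf_eq0 orbb => /eqP. Qed.

Lemma mul0_cancel (a b : F) : a != 0 -> a * b = 0 -> b = 0.
Proof. by move=> a0 /eqP; rewrite mulf_eq0 (negPf a0) => /eqP. Qed.

Lemma absurd_eq0 (b a : F) : b != 0 -> a = b -> a = 0 -> False.
Proof. by move=> b0 -> b00; rewrite b00 eqxx in b0. Qed.

Notation e1 := (X 1 0 0 0).
Notation e2 := (X 0 1 0 0).
Notation e3 := (X 0 0 1 0).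
Notation e4 := (X 0 0 0 1).

(* [yes] and [no] answer the current question of the decision tree, [vec]
   introduces a vector by its coordinates, [absurd] refutes an equation e = 0
   whose left-hand side equals a nonzero scalar. *)
Ltac yes := rewrite if_true; last first.
Ltac no := rewrite if_false; last first.
Tactic Notation "vec" constr(fr) ident(a1) ident(a2) ident(a3) ident(a4) :=
  let a := fresh in
  intro a; destruct (frame_span fr a) as (a1 & a2 & a3 & a4 & ->).
Tactic Notation "zero" constr(lc0) := apply/lc0; split=> //; ring.
Tactic Notation "absurd" constr(b) := by apply: (absurd_eq0 b); ring.
Ltac table fr := rewrite !(frame_mul fr) /mcoef /tcoef /= ?regular_scaleE;
  congr lc; ring.
Tactic Notation "not_on_line" constr(fr) constr(mulE) constr(a) constr(b) constr(d) constr(n) :=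
  let h := fresh in
  move=> /(products_minor fr)/(_ a b d n); rewrite !mulE => h;
  have := h _ _ _ _ _ _ _ _ erefl erefl; clear h; case.
Tactic Notation "squares_not_on_line" constr(fr) constr(mulE) constr(a) constr(b) :=
  let h := fresh in
  move=> /(squares_minor fr)/(_ a b); rewrite !mulE => h;
  have := h _ _ _ _ _ _ _ _ erefl erefl; clear h.
Tactic Notation "on_line" constr(fr) constr(mulE) :=
  exists e4; vec fr a1 a2 a3 a4; vec fr b1 b2 b3 b4;
  rewrite mulE; eexists; exact: lc4_line.

Lemma classify1 : frame 1 -> classify B = 1%N.
Proof.
move=> fr; have lc0 := frame_lc0 fr.
have mulE a1 a2 a3 a4 b1 b2 b3 b4 : X a1 a2 a3 a4 ** X b1 b2 b3 b4 =
  X 0 0 0 (a1 * b3 + a3 * b2) by table fr.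
rewrite /classify.
yes. on_line fr mulE.
no. move=> /(_ e1 e3); rewrite !mulE => /(lc_inj fr)[_ _ _].
  by move=> /eqP; rewrite -subr_eq0 => /eqP; absurd (oner_neq0 F).
no. move=> /(_ e1 e3); rewrite lcD !mulE => h.
  have /lc0[_ _ _] := h (ltac:(zero lc0)) (ltac:(zero lc0)).
  absurd (oner_neq0 F).
yes. exists (X 1 (-1) 0 0), e3; split.
    by rewrite mulE => /lc0[_ _ _]; absurd (oner_neq0 F).
  by vec fr a1 a2 a3 a4; rewrite !mulE lcD; zero lc0.
yes. exists e2, e3; split.
    by rewrite mulE => /lc0[_ _ _]; absurd (oner_neq0 F).
  by vec fr a1 a2 a3 a4; rewrite !mulE; zero lc0.
by [].
Qed.

Lemma classify2 : frame 2 -> classify B = 2%N.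
Proof.
move=> fr; have lc0 := frame_lc0 fr.
have mulE a1 a2 a3 a4 b1 b2 b3 b4 : X a1 a2 a3 a4 ** X b1 b2 b3 b4 =
  X 0 0 0 (a1 * b3 + a2 * b2 + a2 * b3 + a3 * b1 - a3 * b2) by table fr.
rewrite /classify.
yes. on_line fr mulE.
no. move=> /(_ e2 e3); rewrite !mulE => /(lc_inj fr)[_ _ _].
  by move=> /eqP; rewrite -subr_eq0 => /eqP; absurd two_neq0.
no. move=> /(_ e1 e3); rewrite lcD !mulE => h.
  have /lc0[_ _ _] := h (ltac:(zero lc0)) (ltac:(zero lc0)).
  absurd two_neq0.
no. move=> [a [b []]]; move: a b.
  vec fr a1 a2 a3 a4; vec fr b1 b2 b3 b4; rewrite mulE => nz h; apply: nz.
  have := h e1; rewrite !mulE lcD => /lc0[_ _ _ h1].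
  have {h1} a30 : a3 = 0 by apply: (mul0_cancel two_neq0); rewrite -h1; ring.
  have := h e2; rewrite !mulE lcD a30 => /lc0[_ _ _ h2].
  have {h2} a20 : a2 = 0 by apply: (mul0_cancel two_neq0); rewrite -h2; ring.
  have := h e3; rewrite !mulE lcD a30 a20 => /lc0[_ _ _ h3].
  have {h3} a10 : a1 = 0 by apply: (mul0_cancel two_neq0); rewrite -h3; ring.
  by rewrite ?a10 ?a20 ?a30; zero lc0.
yes. vec fr a1 a2 a3 a4 => h; rewrite mulE.
  have := h e2; rewrite !mulE => /(lc_inj fr)[_ _ _ /eqP]; rewrite -subr_eq0 => /eqP h2.
  have {h2} a30 : a3 = 0 by apply: (mul0_cancel two_neq0); rewrite -[RHS]oppr0 -h2;
    ring.
  have := h e3; rewrite !mulE => /(lc_inj fr)[_ _ _ /eqP]; rewrite -subr_eq0 => /eqP h3.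
  have {h3} a20 : a2 = 0 by apply: (mul0_cancel two_neq0); rewrite -h3 ?a30; ring.
  by rewrite ?a20 ?a30; zero lc0.
by [].
Qed.

Lemma classify3 : frame 3 -> classify B = 3%N.
Proof.
move=> fr; have lc0 := frame_lc0 fr.
have mulE a1 a2 a3 a4 b1 b2 b3 b4 : X a1 a2 a3 a4 ** X b1 b2 b3 b4 =
  X 0 0 0 (a1 * b2 - a2 * b1 + a3 * b3) by table fr.
rewrite /classify.
yes. on_line fr mulE.
no. move=> /(_ e1 e2); rewrite !mulE => /(lc_inj fr)[_ _ _].
  by move=> /eqP; rewrite -subr_eq0 => /eqP; absurd two_neq0.
yes. vec fr a1 a2 a3 a4; vec fr b1 b2 b3 b4; rewrite lcD !mulE.
  move=> /lc0[_ _ _ ha] /lc0[_ _ _ hb].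
  have {}ha : a3 = 0 by apply: sq0; rewrite -ha; ring.
  have {}hb : b3 = 0 by apply: sq0; rewrite -hb; ring.
  by rewrite ha hb; zero lc0.
by [].
Qed.

Lemma classify4 : frame 4 -> classify B = 4%N.
Proof.
move=> fr; have lc0 := frame_lc0 fr.
have mulE a1 a2 a3 a4 b1 b2 b3 b4 : X a1 a2 a3 a4 ** X b1 b2 b3 b4 =
  X 0 0 0 (a1 * b2 - a2 * b1 + a2 * b2 + a3 * b3) by table fr.
rewrite /classify.
yes. on_line fr mulE.
no. move=> /(_ e1 e2); rewrite !mulE => /(lc_inj fr)[_ _ _].
  by move=> /eqP; rewrite -subr_eq0 => /eqP; absurd two_neq0.
no. have [i i2] := sqrtF (-1).
  move=> /(_ (X 0 1 i 0) (X 0 1 (- i) 0)); rewrite lcD !mulE => h.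
  have /lc0[_ _ _] : X 0 0 0 (2 * 2) = 0.
    rewrite -[RHS]h; first (by congr lc; ring);
      by apply/lc0; split=> //; rewrite ?mulrNN i2; ring.
  absurd (mulf_neq0 two_neq0 two_neq0).
yes. exists e1, e2; split.
    by rewrite mulE => /lc0[_ _ _]; absurd (oner_neq0 F).
  by vec fr a1 a2 a3 a4; rewrite !mulE lcD; zero lc0.
no. move=> [a [b []]]; move: a b.
  vec fr a1 a2 a3 a4; vec fr b1 b2 b3 b4; rewrite mulE => nz h; apply: nz.
  have := h e1; rewrite mulE => /lc0[_ _ _ h1].
  have {h1} a20 : a2 = 0 by rewrite -[RHS]oppr0 -h1; ring.
  have := h e2; rewrite mulE a20 => /lc0[_ _ _ h2].
  have {h2} a10 : a1 = 0 by rewrite -h2; ring.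
  have := h e3; rewrite mulE => /lc0[_ _ _ h3].
  have {h3} a30 : a3 = 0 by rewrite -h3; ring.
  by rewrite ?a10 ?a20 ?a30; zero lc0.
by [].
Qed.

Lemma classify5 : frame 5 -> classify B = 5%N.
Proof.
move=> fr; have lc0 := frame_lc0 fr.
have mulE a1 a2 a3 a4 b1 b2 b3 b4 : X a1 a2 a3 a4 ** X b1 b2 b3 b4 =
  X 0 0 0 (a1 * b2 + c * (a2 * b1) + a3 * b3) by table fr.
have [/eqP c1 /eqP cN1] := frame_adm fr.
have sc : 1 + c != 0 by rewrite addrC -[1]opprK subr_eq0.
have dc : 1 - c != 0 by rewrite subr_eq0 eq_sym.
rewrite /classify.
yes. on_line fr mulE.
no. move=> /(_ e1 e2); rewrite !mulE => /(lc_inj fr)[_ _ _].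
  by move=> /eqP; rewrite -subr_eq0 => /eqP; absurd dc.
no. move=> /(_ e1 e2); rewrite lcD !mulE => h.
  have /lc0[_ _ _] := h (ltac:(zero lc0)) (ltac:(zero lc0)).
  absurd sc.
no. move=> [a [b []]]; move: a b.
  vec fr a1 a2 a3 a4; vec fr b1 b2 b3 b4; rewrite mulE => nz h; apply: nz.
  have := h e1; rewrite !mulE lcD => /lc0[_ _ _ h1].
  have {h1} a20 : a2 = 0 by apply: (mul0_cancel sc); rewrite -h1; ring.
  have := h e2; rewrite !mulE lcD => /lc0[_ _ _ h2].
  have {h2} a10 : a1 = 0 by apply: (mul0_cancel sc); rewrite -h2; ring.
  have := h e3; rewrite !mulE lcD => /lc0[_ _ _ h3].
  have {h3} a30 : a3 = 0 by apply: (mul0_cancel two_neq0); rewrite -h3; ring.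
  by rewrite ?a10 ?a20 ?a30; zero lc0.
no. move=> /(_ e3) h.
  have : e3 ** e3 = 0.
    by apply: h; vec fr a1 a2 a3 a4; rewrite !mulE; congr lc; ring.
  by rewrite mulE => /lc0[_ _ _]; absurd (oner_neq0 F).
by [].
Qed.

Lemma classify6 : frame 6 -> classify B = 6%N.
Proof.
move=> fr; have lc0 := frame_lc0 fr.
have mulE a1 a2 a3 a4 b1 b2 b3 b4 : X a1 a2 a3 a4 ** X b1 b2 b3 b4 =
  X 0 0 0 (a1 * b1 + a2 * b2 + a3 * b3) by table fr.
rewrite /classify.
yes. on_line fr mulE.
yes. by vec fr a1 a2 a3 a4; vec fr b1 b2 b3 b4; rewrite !mulE; congr lc; ring.
by [].
Qed.

Lemma classify7 : frame 7 -> classify B = 7%N.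
Proof.
move=> fr; have lc0 := frame_lc0 fr.
have mulE a1 a2 a3 a4 b1 b2 b3 b4 : X a1 a2 a3 a4 ** X b1 b2 b3 b4 =
  X 0 (a1 * b1) (a1 * b2) (a1 * b3) by table fr.
rewrite /classify.
no. not_on_line fr mulE e1 e1 e1 e2 => + _; absurd (oner_neq0 F).
no. move=> /(_ e1 e1 e1); rewrite !mulE => /lc0[_ _ + _]; absurd (oner_neq0 F).
no. move=> /(_ e1 e1 e1 e1); rewrite !mulE => /lc0[_ _ _]; absurd (oner_neq0 F).
by [].
Qed.

Lemma classify8 : frame 8 -> classify B = 8%N.
Proof.
move=> fr; have lc0 := frame_lc0 fr.
have mulE a1 a2 a3 a4 b1 b2 b3 b4 : X a1 a2 a3 a4 ** X b1 b2 b3 b4 =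
  X 0 0 (a1 * b2 - a2 * b1) (a1 * b1) by table fr.
rewrite /classify.
no. not_on_line fr mulE e1 e2 e1 e1 => _; absurd (oner_neq0 F).
yes. by vec fr a1 a2 a3 a4; vec fr b1 b2 b3 b4; vec fr d1 d2 d3 d4; rewrite !mulE;
  zero lc0.
yes. exists e4; vec fr a1 a2 a3 a4; exists (a1 * a1).
  by rewrite mulE lcZ; congr lc; ring.
yes. vec fr a1 a2 a3 a4; vec fr b1 b2 b3 b4; rewrite lcD !mulE.
  move=> /lc0[_ _ _ /sq0 ha] /lc0[_ _ _ /sq0 hb].
  by rewrite ha hb; zero lc0.
by [].
Qed.

Lemma classify9 : frame 9 -> classify B = 9%N.
Proof.
move=> fr; have lc0 := frame_lc0 fr.
have mulE a1 a2 a3 a4 b1 b2 b3 b4 : X a1 a2 a3 a4 ** X b1 b2 b3 b4 =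
  X 0 0 (a1 * b2 - a2 * b1) (a1 * b1 + a2 * b2) by table fr.
rewrite /classify.
no. not_on_line fr mulE e1 e2 e1 e1 => _; absurd (oner_neq0 F).
yes. by vec fr a1 a2 a3 a4; vec fr b1 b2 b3 b4; vec fr d1 d2 d3 d4; rewrite !mulE;
  zero lc0.
yes. exists e4; vec fr a1 a2 a3 a4; exists (a1 * a1 + a2 * a2).
  by rewrite mulE lcZ; congr lc; ring.
no. have [i i2] := sqrtF (-1).
  move=> /(_ (X 1 i 0 0) (X 1 (- i) 0 0)); rewrite lcD !mulE => h.
  have /lc0[_ _ _] : X 0 0 0 (2 * 2) = 0.
    rewrite -[RHS]h; first (by congr lc; ring);
      by apply/lc0; split=> //; rewrite ?mulrNN ?i2; ring.
  absurd (mulf_neq0 two_neq0 two_neq0).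
by [].
Qed.

Lemma classify10 : frame 10 -> classify B = 10%N.
Proof.
move=> fr; have lc0 := frame_lc0 fr.
have mulE a1 a2 a3 a4 b1 b2 b3 b4 : X a1 a2 a3 a4 ** X b1 b2 b3 b4 =
  X 0 0 (a1 * b2 - a2 * b1) (a1 * b1 + a1 * b3 - a3 * b1) by table fr.
have N1 : -1 != 0 :> F by rewrite oppr_eq0 oner_neq0.
rewrite /classify.
no. not_on_line fr mulE e1 e2 e1 e1 => _; absurd (oner_neq0 F).
no. move=> /(_ e1 e1 e2); rewrite !mulE => /lc0[_ _ _]; absurd (oner_neq0 F).
yes. by vec fr a1 a2 a3 a4; vec fr b1 b2 b3 b4; vec fr d1 d2 d3 d4; vec fr n1 n2 n3 n4;
  rewrite !mulE; zero lc0.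
no. move=> /(_ e1 e2 e1); rewrite !mulE => /lc0[_ _ _]; absurd N1.
yes. vec fr a1 a2 a3 a4 => /(_ e1 e2); rewrite !mulE => /lc0[_ _ _ h].
  have {h} a10 : a1 = 0 by rewrite -h; ring.
  by rewrite a10; zero lc0.
yes. vec fr a1 a2 a3 a4; vec fr b1 b2 b3 b4; rewrite lcD !mulE.
  move=> /lc0[_ _ _ ha] /lc0[_ _ _ hb].
  have {}ha : a1 = 0 by apply: sq0; rewrite -ha; ring.
  have {}hb : b1 = 0 by apply: sq0; rewrite -hb; ring.
  by rewrite ha hb; zero lc0.
by [].
Qed.

Lemma classify11 : frame 11 -> classify B = 11%N.
Proof.
move=> fr; have lc0 := frame_lc0 fr.
have mulE a1 a2 a3 a4 b1 b2 b3 b4 : X a1 a2 a3 a4 ** X b1 b2 b3 b4 =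
  X 0 0 (a1 * b2 - a2 * b1) (a2 * b2 + a1 * b3 - a3 * b1) by table fr.
have N1 : -1 != 0 :> F by rewrite oppr_eq0 oner_neq0.
rewrite /classify.
no. not_on_line fr mulE e1 e2 e2 e2 => _; absurd (oner_neq0 F).
no. move=> /(_ e1 e1 e2); rewrite !mulE => /lc0[_ _ _]; absurd (oner_neq0 F).
yes. by vec fr a1 a2 a3 a4; vec fr b1 b2 b3 b4; vec fr d1 d2 d3 d4; vec fr n1 n2 n3 n4;
  rewrite !mulE; zero lc0.
no. move=> /(_ e1 e2 e1); rewrite !mulE => /lc0[_ _ _]; absurd N1.
no. move=> /(_ e2) h; have : e2 ** e2 = 0.
    by apply: h; vec fr a1 a2 a3 a4; vec fr b1 b2 b3 b4; rewrite !mulE; zero lc0.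
  by rewrite mulE => /lc0[_ _ _]; absurd (oner_neq0 F).
yes. vec fr a1 a2 a3 a4; vec fr b1 b2 b3 b4; rewrite lcD !mulE.
  move=> /lc0[_ _ _ ha] /lc0[_ _ _ hb].
  have {}ha : a2 = 0 by apply: sq0; rewrite -ha; ring.
  have {}hb : b2 = 0 by apply: sq0; rewrite -hb; ring.
  by rewrite ha hb; zero lc0.
by [].
Qed.

Lemma classify12 : frame 12 -> classify B = 12%N.
Proof.
move=> fr; have lc0 := frame_lc0 fr.
have mulE a1 a2 a3 a4 b1 b2 b3 b4 : X a1 a2 a3 a4 ** X b1 b2 b3 b4 =
  X 0 0 (a1 * b2 - a2 * b1) (a1 * b1 + a2 * b1 + a1 * b3 - a3 * b1) by table fr.
have N1 : -1 != 0 :> F by rewrite oppr_eq0 oner_neq0.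
rewrite /classify.
no. not_on_line fr mulE e1 e2 e1 e1 => _; absurd (oner_neq0 F).
no. move=> /(_ e1 e1 e2); rewrite !mulE => /lc0[_ _ _]; absurd (oner_neq0 F).
yes. by vec fr a1 a2 a3 a4; vec fr b1 b2 b3 b4; vec fr d1 d2 d3 d4; vec fr n1 n2 n3 n4;
  rewrite !mulE; zero lc0.
no. move=> /(_ e1 e2 e1); rewrite !mulE => /lc0[_ _ _]; absurd N1.
yes. vec fr a1 a2 a3 a4 => /(_ e1 e2); rewrite !mulE => /lc0[_ _ _ h].
  have {h} a10 : a1 = 0 by rewrite -h; ring.
  by rewrite a10; zero lc0.
no. move=> /(_ e2 (X 1 (-1) 0 0)); rewrite lcD !mulE => h.
  have /lc0[_ _ _] := h (ltac:(zero lc0)) (ltac:(zero lc0)).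
  absurd (oner_neq0 F).
by [].
Qed.

Lemma classify13 : frame 13 -> classify B = 13%N.
Proof.
move=> fr; have lc0 := frame_lc0 fr.
have mulE a1 a2 a3 a4 b1 b2 b3 b4 : X a1 a2 a3 a4 ** X b1 b2 b3 b4 =
  X 0 0 (a1 * b2 - a2 * b1) (a2 * b2 + a2 * b1 + a1 * b3 - a3 * b1) by table fr.
have N1 : -1 != 0 :> F by rewrite oppr_eq0 oner_neq0.
rewrite /classify.
no. not_on_line fr mulE e1 e2 e2 e2 => _; absurd (oner_neq0 F).
no. move=> /(_ e1 e1 e2); rewrite !mulE => /lc0[_ _ _]; absurd (oner_neq0 F).
yes. by vec fr a1 a2 a3 a4; vec fr b1 b2 b3 b4; vec fr d1 d2 d3 d4; vec fr n1 n2 n3 n4;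
  rewrite !mulE; zero lc0.
no. move=> /(_ e1 e2 e1); rewrite !mulE => /lc0[_ _ _]; absurd N1.
no. move=> /(_ e2) h; have : e2 ** e2 = 0.
    by apply: h; vec fr a1 a2 a3 a4; vec fr b1 b2 b3 b4; rewrite !mulE; zero lc0.
  by rewrite mulE => /lc0[_ _ _]; absurd (oner_neq0 F).
no. move=> /(_ e1 (X (-1) 1 0 0)); rewrite lcD !mulE => h.
  have /lc0[_ _ _] := h (ltac:(zero lc0)) (ltac:(zero lc0)).
  absurd (oner_neq0 F).
by [].
Qed.

Lemma classify14 : frame 14 -> classify B = 14%N.
Proof.
move=> fr; have lc0 := frame_lc0 fr.
have mulE a1 a2 a3 a4 b1 b2 b3 b4 : X a1 a2 a3 a4 ** X b1 b2 b3 b4 =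
  X 0 0 (a1 * b1) (a1 * b2) by table fr.
rewrite /classify.
no. not_on_line fr mulE e1 e1 e1 e2 => _; absurd (oner_neq0 F).
yes. by vec fr a1 a2 a3 a4; vec fr b1 b2 b3 b4; vec fr d1 d2 d3 d4; rewrite !mulE;
  zero lc0.
no. squares_not_on_line fr mulE e1 (X 1 1 0 0); absurd (oner_neq0 F).
no. move=> [_ /(_ e2 e1) h]; move: h; rewrite !mulE => h.
  have /lc0[_ _ _] := h (ltac:(zero lc0)).
  absurd (oner_neq0 F).
yes. vec fr a1 a2 a3 a4; vec fr b1 b2 b3 b4; rewrite !mulE.
  move=> /lc0[_ _ /sq0 ha _]; rewrite ha.
  by zero lc0.
by [].
Qed.

Lemma classify15 : frame 15 -> classify B = 15%N.
Proof.
move=> fr; have lc0 := frame_lc0 fr.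
have mulE a1 a2 a3 a4 b1 b2 b3 b4 : X a1 a2 a3 a4 ** X b1 b2 b3 b4 =
  X 0 0 (a1 * b1) (a2 * b1) by table fr.
rewrite /classify.
no. not_on_line fr mulE e1 e1 e2 e1 => _; absurd (oner_neq0 F).
yes. by vec fr a1 a2 a3 a4; vec fr b1 b2 b3 b4; vec fr d1 d2 d3 d4; rewrite !mulE;
  zero lc0.
no. squares_not_on_line fr mulE e1 (X 1 1 0 0); absurd (oner_neq0 F).
no. move=> [/(_ e2 e1) h _]; move: h; rewrite !mulE => h.
  have /lc0[_ _ _] := h (ltac:(zero lc0)).
  absurd (oner_neq0 F).
no. move=> /(_ e2 e1); rewrite !mulE => h.
  have /lc0[_ _ _] := h (ltac:(zero lc0)).
  absurd (oner_neq0 F).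
yes. vec fr a1 a2 a3 a4; vec fr b1 b2 b3 b4; rewrite !mulE.
  move=> /lc0[_ _ /sq0 ha _]; rewrite ha.
  by zero lc0.
by [].
Qed.

Lemma classify16 : frame 16 -> classify B = 16%N.
Proof.
move=> fr; have lc0 := frame_lc0 fr.
have mulE a1 a2 a3 a4 b1 b2 b3 b4 : X a1 a2 a3 a4 ** X b1 b2 b3 b4 =
  X 0 0 (a2 * b1 - a2 * b2) (a1 * b2) by table fr.
have N1 : -1 != 0 :> F by rewrite oppr_eq0 oner_neq0.
rewrite /classify.
no. not_on_line fr mulE e2 e1 e1 e2 => _; absurd (oner_neq0 F).
yes. by vec fr a1 a2 a3 a4; vec fr b1 b2 b3 b4; vec fr d1 d2 d3 d4; rewrite !mulE;
  zero lc0.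
no. squares_not_on_line fr mulE e2 (X 1 1 0 0); absurd N1.
no. move=> [/(_ e1 e2) h _]; move: h; rewrite !mulE => h.
  have /lc0[_ _ _] := h (ltac:(zero lc0)).
  absurd (oner_neq0 F).
no. move=> /(_ e1 e2); rewrite !mulE => h.
  have /lc0[_ _ _] := h (ltac:(zero lc0)).
  absurd (oner_neq0 F).
no. move=> /(_ e1 e2); rewrite !mulE => h.
  have /lc0[_ _ + _] := h (ltac:(zero lc0)).
  absurd (oner_neq0 F).
no. move=> /(_ e1 e2); rewrite !mulE => h.
  have [s] := h (ltac:(zero lc0)); rewrite lcZ => /(lc_inj fr)[_ _ /eqP + _].
  by rewrite -subr_eq0 => /eqP; absurd (oner_neq0 F).
by [].
Qed.

Lemma classify17 : frame 17 -> classify B = 17%N.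
Proof.
move=> fr; have lc0 := frame_lc0 fr.
have mulE a1 a2 a3 a4 b1 b2 b3 b4 : X a1 a2 a3 a4 ** X b1 b2 b3 b4 =
  X 0 0 (a1 * b1) (a1 * b2 + c * (a2 * b1)) by table fr.
have [/eqP cN1 /eqP c0] := frame_adm fr.
have sc : 1 + c != 0 by rewrite addrC -[1]opprK subr_eq0.
rewrite /classify.
no. not_on_line fr mulE e1 e1 e1 e2 => _; absurd (oner_neq0 F).
yes. by vec fr a1 a2 a3 a4; vec fr b1 b2 b3 b4; vec fr d1 d2 d3 d4; rewrite !mulE;
  zero lc0.
no. squares_not_on_line fr mulE e1 (X 1 1 0 0); absurd sc.
no. move=> [/(_ e2 e1) h _]; move: h; rewrite !mulE => h.
  have /lc0[_ _ _] := h (ltac:(zero lc0)).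
  absurd c0.
no. move=> /(_ e2 e1); rewrite !mulE => h.
  have /lc0[_ _ _] := h (ltac:(zero lc0)).
  absurd c0.
no. move=> /(_ e2 e1); rewrite !mulE => h.
  have /lc0[_ _ _] := h (ltac:(zero lc0)).
  absurd (oner_neq0 F).
yes. vec fr a1 a2 a3 a4; vec fr b1 b2 b3 b4; rewrite !mulE.
  move=> /lc0[_ _ /sq0 -> _]; exists c^-1; by rewrite lcZ; congr lc; field.
by [].
Qed.

Lemma classify18 : frame 18 -> classify B = 18%N.
Proof.
move=> fr; have lc0 := frame_lc0 fr.
have mulE a1 a2 a3 a4 b1 b2 b3 b4 : X a1 a2 a3 a4 ** X b1 b2 b3 b4 =
  X 0 0 (a1 * b1 + c * (a1 * b2)) (a2 * b1 - a2 * b2) by table fr.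
have N1 : -1 != 0 :> F by rewrite oppr_eq0 oner_neq0.
have /eqP cN1 := frame_adm fr.
have sc : 1 + c != 0 by rewrite addrC -[1]opprK subr_eq0.
rewrite /classify.
no. not_on_line fr mulE e1 e1 e2 e1 => _; absurd (oner_neq0 F).
yes. by vec fr a1 a2 a3 a4; vec fr b1 b2 b3 b4; vec fr d1 d2 d3 d4; rewrite !mulE;
  zero lc0.
no. squares_not_on_line fr mulE e1 e2; absurd N1.
yes. have iso a1 a2 a3 a4 : X a1 a2 a3 a4 ** X a1 a2 a3 a4 = 0 -> a1 = 0 /\ a2 = 0.
    rewrite mulE => /lc0[_ _ h3 h4].
    have /eqP : a2 * (a1 - a2) = 0 by rewrite -h4; ring.
    rewrite mulf_eq0 subr_eq0 => /orP[/eqP a20|/eqP a12].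
      by split=> //; apply: sq0; rewrite -h3 a20; ring.
    have a20 : a2 = 0.
      by apply: sq0; apply: (mul0_cancel sc); rewrite -h3 a12; ring.
    by rewrite a12.
  by split; vec fr a1 a2 a3 a4; vec fr b1 b2 b3 b4; move=> /iso[-> ->]; rewrite mulE;
    zero lc0.
no. move=> /(_ e2 (X 1 1 0 0) e1 e1 (X c (-1) 0 0) e1); rewrite !mulE => h.
  have /lc0[_ _ _] := h (ltac:(zero lc0)) (ltac:(by move=> /lc0[_ _ + _]; absurd sc))
    (ltac:(zero lc0)) (ltac:(by move=> /lc0[_ _ + _]; absurd (oner_neq0 F))).
  absurd sc.
by [].
Qed.

Lemma classify19 : frame 19 -> classify B = 19%N.
Proof.
move=> fr; have lc0 := frame_lc0 fr.
have mulE a1 a2 a3 a4 b1 b2 b3 b4 : X a1 a2 a3 a4 ** X b1 b2 b3 b4 =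
  X 0 0 (a1 * b1 + a1 * b2 + a2 * b1) (a2 * b1 + a2 * b2) by table fr.
rewrite /classify.
no. not_on_line fr mulE e1 e1 e2 e2 => _; absurd (oner_neq0 F).
yes. by vec fr a1 a2 a3 a4; vec fr b1 b2 b3 b4; vec fr d1 d2 d3 d4; rewrite !mulE;
  zero lc0.
no. squares_not_on_line fr mulE e1 e2; absurd (oner_neq0 F).
yes. have iso a1 a2 a3 a4 : X a1 a2 a3 a4 ** X a1 a2 a3 a4 = 0 -> a1 = 0 /\ a2 = 0.
    rewrite mulE => /lc0[_ _ h3 h4].
    have /eqP : a2 * (a1 + a2) = 0 by rewrite -h4; ring.
    rewrite mulf_eq0 addr_eq0 => /orP[/eqP a20|/eqP a12].
      by split=> //; apply: sq0; rewrite -h3 a20; ring.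
    have a20 : a2 = 0 by apply: sq0; rewrite -[RHS]oppr0 -h3 a12; ring.
    by rewrite a12 a20 oppr0.
  by split; vec fr a1 a2 a3 a4; vec fr b1 b2 b3 b4; move=> /iso[-> ->]; rewrite mulE;
    zero lc0.
yes. have zd a1 a2 a3 a4 b1 b2 b3 b4 : X a1 a2 a3 a4 ** X b1 b2 b3 b4 = 0 ->
      (b1 = 0 /\ b2 = 0) \/ (a2 = 0 /\ a1 * (b1 + b2) = 0).
    rewrite mulE => /lc0[_ _ h3 h4].
    have /eqP : a2 * (b1 + b2) = 0 by rewrite -h4; ring.
    rewrite mulf_eq0 => /orP[/eqP a20|/eqP b12].
      by right; split=> //; rewrite -h3 a20; ring.
    have /eqP : a2 * b1 = 0.
      have -> : a2 * b1 = (a1 * b1 + a1 * b2 + a2 * b1) - a1 * (b1 + b2) by ring.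
      by rewrite h3 b12; ring.
    rewrite mulf_eq0 => /orP[/eqP a20|/eqP b10].
      by right; rewrite b12 mulr0.
    by left; split=> //; rewrite -b12 b10 add0r.
  vec fr u1 u2 u3 u4; vec fr v1 v2 v3 v4; vec fr w1 w2 w3 w4.
  vec fr s1 s2 s3 s4; vec fr t1 t2 t3 t4; vec fr r1 r2 r3 r4.
  move=> /zd[[-> ->]|[-> _]] nwv; first by case: nwv; rewrite mulE; zero lc0.
  move=> /zd[[-> ->]|[-> h]] nsr; first by rewrite mulE; zero lc0.
  move/eqP: h; rewrite mulf_eq0 => /orP[/eqP s10|/eqP t12].
    by case: nsr; rewrite s10 mulE; zero lc0.
  have -> : t2 = - t1 by apply/eqP; rewrite -addr_eq0 addrC t12.
  by rewrite mulE; zero lc0.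
by [].
Qed.

Lemma classify20 : frame 20 -> classify B = 20%N.
Proof.
move=> fr; have lc0 := frame_lc0 fr.
have mulE a1 a2 a3 a4 b1 b2 b3 b4 : X a1 a2 a3 a4 ** X b1 b2 b3 b4 =
  X 0 0 (a1 * b2) (a1 * b3) by table fr.
rewrite /classify.
no. not_on_line fr mulE e1 e2 e1 e3 => _; absurd (oner_neq0 F).
no. move=> /(_ e1 e1 e2); rewrite !mulE => /lc0[_ _ _]; absurd (oner_neq0 F).
yes. by vec fr a1 a2 a3 a4; vec fr b1 b2 b3 b4; vec fr d1 d2 d3 d4; vec fr n1 n2 n3 n4;
  rewrite !mulE; zero lc0.
yes. by vec fr a1 a2 a3 a4; vec fr b1 b2 b3 b4; vec fr d1 d2 d3 d4; rewrite !mulE;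
  zero lc0.
no. move=> /(_ e2 e1 e1) h; have : e1 ** (e1 ** e2) = 0.
    by apply: h; vec fr a1 a2 a3 a4; vec fr b1 b2 b3 b4; rewrite !mulE; zero lc0.
  by rewrite !mulE => /lc0[_ _ _]; absurd (oner_neq0 F).
yes. vec fr a1 a2 a3 a4 => /(_ e1 e2); rewrite !mulE => /lc0[_ _ _ h].
  have {h} a10 : a1 = 0 by rewrite -h; ring.
  by rewrite a10; zero lc0.
yes. vec fr a1 a2 a3 a4; vec fr b1 b2 b3 b4 => /(_ e1 e2);
  rewrite !mulE => /lc0[_ _ _ h].
  have {h} a10 : a1 = 0 by rewrite -h; ring.
  by rewrite a10; zero lc0.
by [].
Qed.

Lemma classify21 : frame 21 -> classify B = 21%N.
Proof.
move=> fr; have lc0 := frame_lc0 fr.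
have mulE a1 a2 a3 a4 b1 b2 b3 b4 : X a1 a2 a3 a4 ** X b1 b2 b3 b4 =
  X 0 0 (a1 * b2) (a2 * b2 + a1 * b3) by table fr.
rewrite /classify.
no. not_on_line fr mulE e1 e2 e1 e3 => _; absurd (oner_neq0 F).
no. move=> /(_ e1 e1 e2); rewrite !mulE => /lc0[_ _ _]; absurd (oner_neq0 F).
yes. by vec fr a1 a2 a3 a4; vec fr b1 b2 b3 b4; vec fr d1 d2 d3 d4; vec fr n1 n2 n3 n4;
  rewrite !mulE; zero lc0.
yes. by vec fr a1 a2 a3 a4; vec fr b1 b2 b3 b4; vec fr d1 d2 d3 d4; rewrite !mulE;
  zero lc0.
no. move=> /(_ e2 e1 e1) h; have : e1 ** (e1 ** e2) = 0.
    by apply: h; vec fr a1 a2 a3 a4; vec fr b1 b2 b3 b4; rewrite !mulE; zero lc0.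
  by rewrite !mulE => /lc0[_ _ _]; absurd (oner_neq0 F).
no. move=> /(_ e2) h; have : e2 ** e2 = 0.
    by apply: h; vec fr a1 a2 a3 a4; vec fr b1 b2 b3 b4; rewrite !mulE; zero lc0.
  by rewrite mulE => /lc0[_ _ _]; absurd (oner_neq0 F).
yes. vec fr a1 a2 a3 a4; vec fr b1 b2 b3 b4 => /(_ e1 e2);
  rewrite !mulE => /lc0[_ _ _ h].
  have {h} a10 : a1 = 0 by rewrite -h; ring.
  move=> /(_ e1); rewrite !mulE => /lc0[_ _ _ h] nk.
  have {h} /eqP : b1 * b2 = 0 by rewrite -h; ring.
  rewrite mulf_eq0 => /orP[/eqP b10|/eqP b20]; last by rewrite a10 b20; zero lc0.
  by case: nk; rewrite b10; vec fr d1 d2 d3 d4; vec fr n1 n2 n3 n4; rewrite !mulE;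
    zero lc0.
by [].
Qed.

Lemma classify22 : frame 22 -> classify B = 22%N.
Proof.
move=> fr; have lc0 := frame_lc0 fr.
have mulE a1 a2 a3 a4 b1 b2 b3 b4 : X a1 a2 a3 a4 ** X b1 b2 b3 b4 =
  X 0 0 (a1 * b2) (a2 * b1 + a1 * b3) by table fr.
rewrite /classify.
no. not_on_line fr mulE e1 e2 e1 e3 => _; absurd (oner_neq0 F).
no. move=> /(_ e1 e1 e2); rewrite !mulE => /lc0[_ _ _]; absurd (oner_neq0 F).
yes. by vec fr a1 a2 a3 a4; vec fr b1 b2 b3 b4; vec fr d1 d2 d3 d4; vec fr n1 n2 n3 n4;
  rewrite !mulE; zero lc0.
yes. by vec fr a1 a2 a3 a4; vec fr b1 b2 b3 b4; vec fr d1 d2 d3 d4; rewrite !mulE;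
  zero lc0.
no. move=> /(_ e2 e1 e1) h; have : e1 ** (e1 ** e2) = 0.
    by apply: h; vec fr a1 a2 a3 a4; vec fr b1 b2 b3 b4; rewrite !mulE; zero lc0.
  by rewrite !mulE => /lc0[_ _ _]; absurd (oner_neq0 F).
yes. vec fr a1 a2 a3 a4 => /(_ e1 e2); rewrite !mulE => /lc0[_ _ _ h].
  have {h} a10 : a1 = 0 by rewrite -h; ring.
  by rewrite a10; zero lc0.
no. move=> /(_ e2 e1) h; have : e2 ** e1 = 0.
    by apply: h; vec fr a1 a2 a3 a4; vec fr b1 b2 b3 b4; rewrite !mulE; zero lc0.
  by rewrite mulE => /lc0[_ _ _]; absurd (oner_neq0 F).
by [].
Qed.

Lemma classify23 : frame 23 -> classify B = 23%N.
Proof.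
move=> fr; have lc0 := frame_lc0 fr.
have mulE a1 a2 a3 a4 b1 b2 b3 b4 : X a1 a2 a3 a4 ** X b1 b2 b3 b4 =
  X 0 0 (a1 * b2) (a2 * b1 + a2 * b2 + a1 * b3) by table fr.
rewrite /classify.
no. not_on_line fr mulE e1 e2 e1 e3 => _; absurd (oner_neq0 F).
no. move=> /(_ e1 e1 e2); rewrite !mulE => /lc0[_ _ _]; absurd (oner_neq0 F).
yes. by vec fr a1 a2 a3 a4; vec fr b1 b2 b3 b4; vec fr d1 d2 d3 d4; vec fr n1 n2 n3 n4;
  rewrite !mulE; zero lc0.
yes. by vec fr a1 a2 a3 a4; vec fr b1 b2 b3 b4; vec fr d1 d2 d3 d4; rewrite !mulE;
  zero lc0.
no. move=> /(_ e2 e1 e1) h; have : e1 ** (e1 ** e2) = 0.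
    by apply: h; vec fr a1 a2 a3 a4; vec fr b1 b2 b3 b4; rewrite !mulE; zero lc0.
  by rewrite !mulE => /lc0[_ _ _]; absurd (oner_neq0 F).
no. move=> /(_ e2) h; have : e2 ** e2 = 0.
    by apply: h; vec fr a1 a2 a3 a4; vec fr b1 b2 b3 b4; rewrite !mulE; zero lc0.
  by rewrite mulE => /lc0[_ _ _]; absurd (oner_neq0 F).
no. move=> /(_ e2 e1) h; have : e2 ** e1 = 0.
    apply: h.
    - by vec fr a1 a2 a3 a4; vec fr b1 b2 b3 b4; rewrite !mulE; zero lc0.
    - by vec fr a1 a2 a3 a4; rewrite !mulE; zero lc0.
    - by move=> /(_ e1 e2); rewrite !mulE => /lc0[_ _ _]; absurd (oner_neq0 F).
  by rewrite mulE => /lc0[_ _ _]; absurd (oner_neq0 F).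
by [].
Qed.

Lemma classify24 : frame 24 -> classify B = 24%N.
Proof.
move=> fr; have lc0 := frame_lc0 fr.
have mulE a1 a2 a3 a4 b1 b2 b3 b4 : X a1 a2 a3 a4 ** X b1 b2 b3 b4 =
  X 0 0 (a1 * b1) (a2 * b1 + a1 * b3) by table fr.
rewrite /classify.
no. not_on_line fr mulE e1 e1 e1 e3 => _; absurd (oner_neq0 F).
no. move=> /(_ e1 e1 e1); rewrite !mulE => /lc0[_ _ _]; absurd (oner_neq0 F).
yes. by vec fr a1 a2 a3 a4; vec fr b1 b2 b3 b4; vec fr d1 d2 d3 d4; vec fr n1 n2 n3 n4;
  rewrite !mulE; zero lc0.
yes. by vec fr a1 a2 a3 a4; vec fr b1 b2 b3 b4; vec fr d1 d2 d3 d4; rewrite !mulE;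
  zero lc0.
yes. vec fr a1 a2 a3 a4; vec fr b1 b2 b3 b4; vec fr d1 d2 d3 d4 => /(_ e1 e1);
  rewrite !mulE => /lc0[_ _ _ h].
  have {h} a10 : a1 = 0 by rewrite -h; ring.
  by rewrite a10; zero lc0.
yes. vec fr a1 a2 a3 a4 => /(_ e1 e1); rewrite !mulE => /lc0[_ _ _ h].
  have {h} a10 : a1 = 0 by rewrite -h; ring.
  by rewrite a10; zero lc0.
by [].
Qed.

Lemma classify25 : frame 25 -> classify B = 25%N.
Proof.
move=> fr; have lc0 := frame_lc0 fr.
have mulE a1 a2 a3 a4 b1 b2 b3 b4 : X a1 a2 a3 a4 ** X b1 b2 b3 b4 =
  X 0 0 (a1 * b1) (a2 * b2 + a1 * b3) by table fr.
rewrite /classify.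
no. not_on_line fr mulE e1 e1 e1 e3 => _; absurd (oner_neq0 F).
no. move=> /(_ e1 e1 e1); rewrite !mulE => /lc0[_ _ _]; absurd (oner_neq0 F).
yes. by vec fr a1 a2 a3 a4; vec fr b1 b2 b3 b4; vec fr d1 d2 d3 d4; vec fr n1 n2 n3 n4;
  rewrite !mulE; zero lc0.
yes. by vec fr a1 a2 a3 a4; vec fr b1 b2 b3 b4; vec fr d1 d2 d3 d4; rewrite !mulE;
  zero lc0.
yes. vec fr a1 a2 a3 a4; vec fr b1 b2 b3 b4; vec fr d1 d2 d3 d4 => /(_ e1 e1);
  rewrite !mulE => /lc0[_ _ _ h].
  have {h} a10 : a1 = 0 by rewrite -h; ring.
  by rewrite a10; zero lc0.
no. move=> /(_ e2) h; have : e2 ** e2 = 0.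
    by apply: h; vec fr a1 a2 a3 a4; vec fr b1 b2 b3 b4; rewrite !mulE; zero lc0.
  by rewrite mulE => /lc0[_ _ _]; absurd (oner_neq0 F).
by [].
Qed.

End Classification.

(** * Nonisomorphism *)

Section Uniqueness.
Variable F : fieldType.
Hypotheses (two_neq0 : 2 != 0 :> F) (sqrtF : forall a : F, exists b, b * b = a).

Lemma classifyP (B : leibnizAlg F) k :
  (1 <= k <= 25)%N -> of_class k B -> classify B = k.
Proof.
move=> hk /of_class_frame[c [x1 [x2 [x3 [x4 fr]]]]]; move: hk fr.
do 26?[case: k => [|k] //]; move=> _ fr;
  [exact: classify1 fr | apply: classify2 fr | apply: classify3 fr
  |apply: classify4 fr | apply: classify5 fr | exact: classify6 fr
  |exact: classify7 fr | exact: classify8 fr | apply: classify9 fr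
  |exact: classify10 fr | exact: classify11 fr | exact: classify12 fr
  |exact: classify13 fr | exact: classify14 fr | exact: classify15 fr
  |exact: classify16 fr | exact: classify17 fr | exact: classify18 fr
  |exact: classify19 fr | exact: classify20 fr | exact: classify21 fr
  |exact: classify22 fr | exact: classify23 fr | exact: classify24 fr
  |exact: classify25 fr]; assumption.
Qed.

Lemma of_class_iso (B B' : leibnizAlg F) k :
  leibniz_iso B B' -> of_class k B -> of_class k B'.
Proof.
move=> [f [[g gK fK] fM]] [c [x [adm bas tab]]].
have lf a : linfun f a = f a by rewrite lfunE.
have f_lc x1 x2 x3 x4 a1 a2 a3 a4 :
    f (lc x1 x2 x3 x4 a1 a2 a3 a4) = lc (f x1) (f x2) (f x3) (f x4) a1 a2 a3 a4.
  by rewrite /lc !linearD !linearZ.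
have fx n : (n < 4)%N -> (map_tuple f x)`_n = f x`_n.
  by move=> hn; rewrite (nth_map 0) // size_tuple.
exists c, (map_tuple f x); split=> //; last first.
  move=> i j; by rewrite !fx // -fM tab !leibniz_productE f_lc.
have f0 : lker (linfun f) == 0%VS.
  by apply/lker0P => a b; rewrite !lf => /(can_inj gK).
have full : (linfun f @: {:B} = {:B'})%VS.
  apply/eqP; rewrite eqEsubv subvf; apply/subvP => v _.
  by rewrite -(fK v) -lf memv_img // memvf.
have dims : \dim {:B'} = 4%N.
  by rewrite -full limg_dim_eq ?(size_basis bas) // (eqP f0) capv0.
rewrite basisEdim size_tuple dims leqnn andbT.
have -> : map_tuple f x = map (linfun f) x :> seq _ by apply: eq_map => a; rewrite lf.
by rewrite -limg_span (span_basis bas) full subvv.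
Qed.

Lemma of_class_inj (B B' : leibnizAlg F) i j :
    (1 <= i <= 25)%N -> (1 <= j <= 25)%N -> of_class i B -> of_class j B' ->
  leibniz_iso B B' -> i = j.
Proof.
move=> hi hj Bi Bj iso; have {}Bi := of_class_iso iso Bi.
by rewrite -(classifyP hi Bi) (classifyP hj Bj).
Qed.

End Uniqueness.

(** * Generating families *)

Section Generating.
Variables (F : fieldType) (A : leibnizAlg F).
Implicit Types (u v w x y z : A) (X Y : seq A).

Definition generates X : Prop := (<<X>> + gam A 1 = {:A})%VS.

Lemma generatesW X Y :
  generates X -> (forall x, x \in X -> x \in (<<Y>> + gam A 1)%VS) -> generates Y.
Proof.
move=> gX XY; apply/eqP; rewrite eqEsubv subvf -gX subv_add addvSr andbT.
exact/span_subvP.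
Qed.

Lemma generates_subset X Y : generates X -> {subset X <= Y} -> generates Y.
Proof.
by move=> gX XY; apply: (generatesW gX) => x /XY xY;
  apply/(subvP (addvSl _ _))/memv_span.
Qed.

Lemma generates_swap u v w : generates [:: u; v; w] -> generates [:: v; u; w].
Proof.
by move=> g; apply: (generates_subset g) => x; rewrite !inE => /or3P[]->; rewrite ?orbT.
Qed.

Lemma generates_rot u v w : generates [:: u; v; w] -> generates [:: w; u; v].
Proof.
by move=> g; apply: (generates_subset g) => x; rewrite !inE => /or3P[]->; rewrite ?orbT.
Qed.

(** Changes of generators are allowed to be inexact modulo the derived
    algebra. *)
Lemma generates2 u v u' v' (p q r s : F) : generates [:: u; v] -> p * s - q * r != 0 ->
  u' - (p *: u + q *: v) \in gam A 1 -> v' - (r *: u + s *: v) \in gam A 1 ->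
  generates [:: u'; v'].
Proof.
move=> guv d0 du dv; apply: (generatesW guv) => x.
have mem y : y \in gam A 1 -> y \in (<<[:: u'; v']>> + gam A 1)%VS.
  exact/subvP/addvSr.
have u'S : u' \in (<<[:: u'; v']>> + gam A 1)%VS.
  by apply/(subvP (addvSl _ _))/memv_span; rewrite inE eqxx.
have v'S : v' \in (<<[:: u'; v']>> + gam A 1)%VS.
  by apply/(subvP (addvSl _ _))/memv_span; rewrite !inE eqxx orbT.
set e := u' - _ in du; set f := v' - _ in dv.
have [eS fS] := (mem _ du, mem _ dv).
have eu : u' = p *: u + q *: v + e by rewrite /e; lmod.
have ev : v' = r *: u + s *: v + f by rewrite /f; lmod.
clearbody e f.
rewrite !inE => /orP[]/eqP->.
  have -> : u = (p * s - q * r)^-1 *: (s *: (u' - e) - q *: (v' - f)).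
    by rewrite eu ev; lmod; field.
  by rewrite !(rpredZ, rpredB).
have -> : v = (p * s - q * r)^-1 *: (p *: (v' - f) - r *: (u' - e)).
  by rewrite eu ev; lmod; field.
by rewrite !(rpredZ, rpredB).
Qed.

Lemma generates3 u v w x y z (p1 p2 p3 q1 q2 q3 r1 r2 r3 : F) : generates [:: u; v;
  w] ->
  p1 * (q2 * r3 - q3 * r2) - p2 * (q1 * r3 - q3 * r1) + p3 * (q1 * r2 - q2 * r1) != 0 ->
  x = p1 *: u + p2 *: v + p3 *: w -> y = q1 *: u + q2 *: v + q3 *: w ->
  z = r1 *: u + r2 *: v + r3 *: w ->
  generates [:: x; y; z].
Proof.
move=> guvw; set D := _ + _ => D0 ex ey ez; apply: (generatesW guvw) => t.
set S := (_ + _)%VS.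
have [xS yS zS] : [/\ x \in S, y \in S & z \in S].
  by split; apply/(subvP (addvSl _ _))/memv_span; rewrite !inE eqxx ?orbT.
have comb (a b c : F) : a *: x + b *: y + c *: z \in S by rewrite !(rpredD, rpredZ).
rewrite !inE => /or3P[]/eqP->.
- have -> : u = (D^-1 * (q2 * r3 - q3 * r2)) *: x + (- D^-1 * (p2 * r3 - p3 * r2)) *: y
                + (D^-1 * (p2 * q3 - p3 * q2)) *: z; last exact: comb.
  by rewrite ex ey ez; lmod; rewrite /D; field.
- have -> : v = (- D^-1 * (q1 * r3 - q3 * r1)) *: x + (D^-1 * (p1 * r3 - p3 * r1)) *: y
                + (- D^-1 * (p1 * q3 - p3 * q1)) *: z; last exact: comb.
  by rewrite ex ey ez; lmod; rewrite /D; field.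
- have -> : w = (D^-1 * (q1 * r2 - q2 * r1)) *: x + (- D^-1 * (p1 * r2 - p2 * r1)) *: y
                + (D^-1 * (p1 * q2 - p2 * q1)) *: z; last exact: comb.
  by rewrite ex ey ez; lmod; rewrite /D; field.
Qed.

Lemma size_generates X : generates X -> (\dim {:A} <= size X + \dim (gam A 1))%N.
Proof.
move=> <-; apply: leq_trans (dimv_add_leqif _ _) _.
by rewrite leq_add2r dim_span.
Qed.

Lemma exists_generates n : (\dim {:A} <= n + \dim (gam A 1))%N ->
  exists2 X, size X = n & generates X.
Proof.
move=> hn; pose X := vbasis (gam A 1)^C.
exists (take n (X ++ nseq n 0)).
  by rewrite size_takel // size_cat size_nseq leq_addl.
have sX : (size X <= n)%N by rewrite size_tuple dimv_compl leq_subLR addnC.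
rewrite take_cat ltnNge sX /= /generates span_cat (span_basis (vbasisP _)).
apply/eqP; rewrite eqEsubv subvf -[X in (X <= _)%VS](addv_complf (gam A 1)).
by rewrite subv_add addvSr -addvA addvSl.
Qed.

End Generating.

(** * Derived algebra of dimension one: bilinear forms on a three-space *)

Definition classified (F : fieldType) (A : leibnizAlg F) : Prop :=
  exists2 k, (1 <= k <= 25)%N & of_class k A.

(* [field], with its nonvanishing conditions taken from the context *)
Ltac fieldz := field; do ?[apply/andP; split]; do ?assumption.

Ltac table4 := case=> -[|[|[|[|//]]]] ? [] [|[|[|[|//]]]] ? /=.

(** In this section the product is [a,b] = f(a,b) x4, where x4 spans the derived
    algebra. The nondegeneracy hypothesis says that no generator is in the
    two-sided radical of f, which is what non-splitness provides. *)

Section Forms.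
Variables (F : fieldType) (A : leibnizAlg F).
Hypotheses (two_neq0 : 2 != 0 :> F) (sqrtF : forall a : F, exists b, b * b = a).
Hypotheses (dimA : \dim {:A} = 4%N) (nilA : nilpotent_leibniz A).
Variables (x4 : A) (f : A -> A -> F).
Hypothesis brkf : forall a b, a ** b = f a b *: x4.
Hypotheses (fDl : forall a b c, f (a + b) c = f a c + f b c)
  (fDr : forall a b c, f a (b + c) = f a b + f a c)
  (fZl : forall (k : F) a b, f (k *: a) b = k * f a b)
  (fZr : forall (k : F) a b, f a (k *: b) = k * f a b).
Hypotheses (f4l : forall a, f x4 a = 0) (f4r : forall a, f a x4 = 0).
Hypothesis nondegenerate : forall u v w, generates [:: u; v; w] ->
  [|| f w u != 0, f w v != 0, f w w != 0, f u w != 0 | f v w != 0].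

Lemma fNl a b : f (- a) b = - f a b.
Proof. by rewrite -scaleN1r fZl mulN1r. Qed.

Lemma fNr a b : f a (- b) = - f a b.
Proof. by rewrite -scaleN1r fZr mulN1r. Qed.

Definition fE := (fDl, fDr, fZl, fZr, fNl, fNr, f4l, f4r).

(** The nine values of the form on a generating triple, row by row. *)
Definition gram u v w (m11 m12 m13 m21 m22 m23 m31 m32 m33 : F) : Prop :=
  [/\ f u u = m11, f u v = m12 & f u w = m13] /\
  [/\ f v u = m21, f v v = m22 & f v w = m23] /\
  [/\ f w u = m31, f w v = m32 & f w w = m33].

Lemma classified_gram k c u v w : (1 <= k <= 25)%N -> admissible k c ->
    generates [:: u; v; w] ->
    (forall i j : 'I_4, brk A [:: u; v; w; x4]`_i [:: u; v; w; x4]`_j =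
       leibniz_product k c u v w x4 i.+1 j.+1) ->
  classified A.
Proof.
move=> hk adm guvw tab; exists k => //.
apply: (of_class_generated dimA nilA adm _ tab).
by apply: (generates_subset guvw) => x; rewrite !inE => /or3P[]->; rewrite ?orbT.
Qed.

Ltac gram_table h :=
  case: h => -[? ? ?] [[? ? ?] [? ? ?]]; table4;
  rewrite brkf ?f4l ?f4r;
  repeat match goal with e : f _ _ = _ |- _ => rewrite ?e; clear e end; lmod.

Lemma gram1 u v w : generates [:: u; v; w] ->
  gram u v w 0 0 1 0 0 0 0 1 0 -> classified A.
Proof. by move=> g h; apply: (@classified_gram 1 0 _ _ _ _ _ g) => //;
  gram_table h. Qed.

Lemma gram2 u v w : generates [:: u; v; w] ->
  gram u v w 0 0 1 0 1 1 1 (-1) 0 -> classified A.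
Proof. by move=> g h; apply: (@classified_gram 2 0 _ _ _ _ _ g) => //;
  gram_table h. Qed.

Lemma gram3 u v w : generates [:: u; v; w] ->
  gram u v w 0 1 0 (-1) 0 0 0 0 1 -> classified A.
Proof. by move=> g h; apply: (@classified_gram 3 0 _ _ _ _ _ g) => //;
  gram_table h. Qed.

Lemma gram4 u v w : generates [:: u; v; w] ->
  gram u v w 0 1 0 (-1) 1 0 0 0 1 -> classified A.
Proof. by move=> g h; apply: (@classified_gram 4 0 _ _ _ _ _ g) => //;
  gram_table h. Qed.

Lemma gram5 c u v w : c != 1 -> c != -1 -> generates [:: u; v; w] ->
  gram u v w 0 1 0 c 0 0 0 0 1 -> classified A.
Proof.
move=> c1 cN1 g h; apply: (@classified_gram 5 c _ _ _ _ _ g) => //.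
  by split; apply/eqP.
by gram_table h.
Qed.

Lemma gram6 u v w : generates [:: u; v; w] ->
  gram u v w 1 0 0 0 1 0 0 0 1 -> classified A.
Proof. by move=> g h; apply: (@classified_gram 6 0 _ _ _ _ _ g) => //;
  gram_table h. Qed.

Section Reductions.
Implicit Types (a b u v w r y z h : A).

(** Here w splits off and the plane of u and v carries a form that is not
    symmetric. In a basis of isotropic vectors of its symmetric part, only the
    ratio of the two mixed values matters; if that symmetric part is degenerate,
    it has rank zero or one. *)
Lemma plane_isotropic u v w : generates [:: u; v; w] -> f u u = 0 -> f u v != f v u ->
  f w w = 1 -> f u w = 0 -> f w u = 0 -> f v w = 0 -> f w v = 0 -> classified A.
Proof.
move=> g uu0 pq ww uw wu vw wv; set p := f u v in pq; set q := f v u in pq.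
have [epq|npq] := eqVneq (p + q) 0.
  have eq : q = - p by apply/eqP; rewrite -addr_eq0 addrC epq.
  have p0 : p != 0 by apply: contraNneq pq => p0; rewrite eq p0 oppr0.
  have [C0|C0] := eqVneq (f v v) 0.
    apply: (@gram3 (p^-1 *: u) v w).
      apply: (generates3 (p1 := p^-1) (p2 := 0) (p3 := 0) (q1 := 0) (q2 := 1) (q3 := 0)
        (r1 := 0) (r2 := 0) (r3 := 1) g); try lmod.
      by rewrite (_ : _ + _ = p^-1) ?invr_eq0 //; ring.
    by rewrite /gram !fE uu0 C0 ww uw wu vw wv -/p -/q eq; do !split; fieldz.
  have [s es] := sqrtF (f v v).
  have s0 : s != 0 by apply: contraNneq C0 => s0; rewrite -es s0 mulr0.
  apply: (@gram4 ((s / p) *: u) (s^-1 *: v) w).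
    apply: (generates3 (p1 := s / p) (p2 := 0) (p3 := 0) (q1 := 0) (q2 := s^-1) (q3 := 0)
        (r1 := 0) (r2 := 0) (r3 := 1) g); try lmod.
    by rewrite (_ : _ + _ = p^-1) ?invr_eq0 //; fieldz.
  by rewrite /gram !fE uu0 -es ww uw wu vw wv -/p -/q eq; do !split; fieldz.
pose t := f v v / (p + q).
have vv' : f (v - t *: u) (v - t *: u) = 0.
  by rewrite !fE uu0 /t -/p -/q; fieldz.
have [p0|p0] := eqVneq p 0.
  have q0 : q != 0 by apply: contraNneq pq => ->; rewrite p0.
  apply: (@gram5 0 (q^-1 *: (v - t *: u)) u w);
    rewrite ?[0 == _]eq_sym ?oppr_eq0 ?oner_neq0 //.
    apply: (generates3 (p1 := - t / q) (p2 := q^-1) (p3 := 0) (q1 := 1) (q2 := 0) (q3 := 0)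
        (r1 := 0) (r2 := 0) (r3 := 1) g); try lmod.
    by rewrite (_ : _ + _ = - q^-1) ?oppr_eq0 ?invr_eq0 //; ring.
  rewrite /gram !(fZl, fZr) vv' !fE uu0 ww uw wu vw wv -/p -/q p0.
  by do !split; fieldz.
apply: (@gram5 (q / p) (p^-1 *: u) (v - t *: u) w).
- by apply: contraNneq pq => e; rewrite -[q](divfK p0) e mul1r.
- by apply: contraNneq npq => e; rewrite -[q](divfK p0) e mulN1r subrr.
- apply: (generates3 (p1 := p^-1) (p2 := 0) (p3 := 0) (q1 := - t) (q2 := 1) (q3 := 0)
        (r1 := 0) (r2 := 0) (r3 := 1) g); try lmod.
  by rewrite (_ : _ + _ = p^-1) ?invr_eq0 //; ring.
rewrite /gram vv' !fE uu0 ww uw wu vw wv -/p -/q.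
by do !split; fieldz.
Qed.

Lemma quadratic_root (a b c : F) : a != 0 -> exists t, a * (t * t) + b * t + c = 0.
Proof.
move=> a0; have [d ed] := sqrtF (b * b - 4 * (a * c)).
exists ((d - b) / (2 * a)).
transitivity ((d * d - (b * b - 4 * (a * c))) / (2 * (2 * a))); last first.
  by rewrite ed subrr mul0r.
by fieldz.
Qed.

(** A quadratic form on a plane always has an isotropic vector, found as a root
    of a quadratic equation. *)
Lemma plane u v w : generates [:: u; v; w] -> f u v != f v u ->
  f w w = 1 -> f u w = 0 -> f w u = 0 -> f v w = 0 -> f w v = 0 -> classified A.
Proof.
move=> g uv ww uw wu vw wv.
have [uu0|uu0] := eqVneq (f u u) 0.
  exact: plane_isotropic g uu0 uv ww uw wu vw wv.
have [t et] := quadratic_root (f u v + f v u) (f v v) uu0.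
apply: (@plane_isotropic (t *: u + v) u w);
  rewrite ?fE ?uw ?wu ?vw ?wv ?mulr0 ?addr0 //.
- apply: (generates3 (p1 := t) (p2 := 1) (p3 := 0) (q1 := 1) (q2 := 0) (q3 := 0)
    (r1 := 0) (r2 := 0) (r3 := 1) g); try lmod.
  by rewrite (_ : _ + _ = -1) ?oppr_eq0 ?oner_neq0 //; ring.
- by rewrite -et; ring.
- by apply: contraNneq uv => e; apply/eqP; apply: (addrI (t * f u u)).
Qed.

(** Here r is an isotropic radical vector of the antisymmetric part, y completes
    it to a hyperbolic plane, and h is orthogonal to r. Adding multiples of r to
    h changes f(h,y) and f(y,h) by the same amount, so only their difference and
    f(h,h) survive. *)
Lemma null_plane r y h p q : generates [:: r; y; h] -> p != q ->
  gram r y h 0 1 0 1 0 q 0 p (f h h) -> classified A.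
Proof.
move=> g pq [[rr ry rh] [[yr yy yh] [hr hy _]]].
have [hh|hh] := eqVneq (f h h) 0.
  have k0 : q - p != 0 by rewrite subr_eq0 eq_sym.
  pose h' := (q - p)^-1 *: (h - p *: r).
  apply: (@gram1 (r - h') h' y).
    apply: (generates3 (p1 := 1 + p / (q - p)) (p2 := 0) (p3 := - (q - p)^-1)
      (q1 := - p / (q - p)) (q2 := 0) (q3 := (q - p)^-1)
      (r1 := 0) (r2 := 1) (r3 := 0) g); rewrite /h'; try lmod.
    by rewrite (_ : _ + _ = - (q - p)^-1) ?oppr_eq0 ?invr_eq0 //; fieldz.
  rewrite /gram /h' !fE rr ry rh yr yy yh hr hy hh.
  by do !split; fieldz.
have [s es] := sqrtF (f h h).
have s0 : s != 0 by apply: contraNneq hh => s0; rewrite -es s0 mulr0.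
have pq0 : p - q != 0 by rewrite subr_eq0.
pose k := (p - q) / (2 * s).
have k0 : k != 0 by rewrite !mulf_neq0 ?invr_eq0 ?mulf_neq0.
pose h' := s^-1 *: (h - ((p + q) / 2) *: r).
apply: (@gram2 (k *: r) h' (k^-1 *: y)).
  apply: (generates3 (p1 := k) (p2 := 0) (p3 := 0)
    (q1 := - ((p + q) / 2) / s) (q2 := 0) (q3 := s^-1)
    (r1 := 0) (r2 := k^-1) (r3 := 0) g); rewrite /h'; try lmod; try by fieldz.
  by rewrite (_ : _ + _ = - s^-1) ?oppr_eq0 ?invr_eq0 //; fieldz.
rewrite /gram /h' !fE rr ry rh yr yy yh hr hy -es /k.
by do !split; fieldz.
Qed.

(** Normalises y and z against r by orthogonal projection, to reach the situation
    of [null_plane]. *)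
Lemma null_radical r y z : generates [:: r; y; z] -> f r r = 0 -> f y r = f r y ->
  f z r = f r z -> f r y != 0 -> f y z != f z y -> classified A.
Proof.
move=> g rr yr zr ry0 yz.
pose y1 := (f r y)^-1 *: y.
pose y2 := y1 - (f y1 y1 / 2) *: r.
pose h := z - (f r z / f r y) *: y.
apply: (@null_plane r y2 h (f h y2) (f y2 h)).
- apply: (generates3 (p1 := 1) (p2 := 0) (p3 := 0)
    (q1 := - (f y1 y1 / 2)) (q2 := (f r y)^-1) (q3 := 0)
    (r1 := 0) (r2 := - (f r z / f r y)) (r3 := 1) g); rewrite /y2 /y1 /h; try lmod.
  by rewrite (_ : _ + _ = (f r y)^-1) ?invr_eq0 //; fieldz.
- rewrite -subr_eq0 /y2 /y1 /h !fE yr zr.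
  rewrite (_ : _ - _ = (f z y - f y z) / f r y); last by fieldz.
  by rewrite mulf_neq0 ?invr_eq0 // subr_eq0 eq_sym.
have h1 : f r y2 = 1 by rewrite /y2 /y1 !fE rr; fieldz.
have h2 : f y2 r = 1 by rewrite /y2 /y1 !fE rr yr; fieldz.
rewrite /gram h1 h2 rr; do !split; rewrite /h ?fE ?yr ?zr; try by fieldz.
by rewrite rr; fieldz.
Qed.

(** The antisymmetric part of the form on a three-space has a radical vector
    r, given by the cross product of its coefficients. Since the form is
    symmetric against r, either r splits off orthogonally, or it is isotropic
    and lies in a hyperbolic plane. *)
Lemma not_symmetric a b e : generates [:: a; b; e] -> f a b != f b a -> classified A.
Proof.
move=> g ab; have kab : f a b - f b a != 0 by rewrite subr_eq0.
pose kae := f a e - f e a; pose kbe := f b e - f e b.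
pose r := kbe *: a - kae *: b + (f a b - f b a) *: e.
have gr : generates [:: a; b; r].
  apply: (generates3 (p1 := 1) (p2 := 0) (p3 := 0) (q1 := 0) (q2 := 1) (q3 := 0)
    (r1 := kbe) (r2 := - kae) (r3 := f a b - f b a) g); rewrite /r; try lmod.
  by rewrite (_ : _ + _ = f a b - f b a) //; ring.
have ra : f r a = f a r by rewrite /r !fE /kae /kbe; ring.
have rb : f r b = f b r by rewrite /r !fE /kae /kbe; ring.
clearbody r.
have [rr|rr] := eqVneq (f r r) 0.
  have [ra0|ra0] := eqVneq (f r a) 0; last first.
    apply: (@null_radical r a b) => //.
    exact: generates_rot.
  have [rb0|rb0] := eqVneq (f r b) 0; last first.
    apply: (@null_radical r b a) => //; last by rewrite eq_sym.
    exact/generates_rot/generates_swap.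
  by have := nondegenerate gr; rewrite -ra -rb ra0 rb0 rr eqxx.
have [s es] := sqrtF (f r r).
have s0 : s != 0 by apply: contraNneq rr => s0; rewrite -es s0 mulr0.
apply: (@plane (a - (f a r / f r r) *: r) (b - (f b r / f r r) *: r) (s^-1 *: r)).
- apply: (generates3 (p1 := 1) (p2 := 0) (p3 := - (f a r / f r r))
    (q1 := 0) (q2 := 1) (q3 := - (f b r / f r r))
    (r1 := 0) (r2 := 0) (r3 := s^-1) gr); try lmod.
  by rewrite (_ : _ + _ = s^-1) ?invr_eq0 //; ring.
- by rewrite -subr_eq0 !fE ra rb (_ : _ - _ = f a b - f b a) //; fieldz.
- by rewrite !fE -es; fieldz.
- by rewrite !fE; fieldz.
- by rewrite !fE ra; fieldz.
- by rewrite !fE; fieldz.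
- by rewrite !fE rb; fieldz.
Qed.

Definition symmetric3 u v w := [/\ f v u = f u v, f w u = f u w & f w v = f v w].

(** The last vector of an orthogonal family is anisotropic by nondegeneracy. *)
Lemma symmetric_two u v w : generates [:: u; v; w] -> symmetric3 u v w ->
  f u u != 0 -> f v v != 0 -> f u v = 0 -> classified A.
Proof.
move=> g [vu wu wv] uu0 vv0 uv.
pose w' := w - (f u w / f u u) *: u - (f v w / f v v) *: v.
have gw : generates [:: u; v; w'].
  apply: (generates3 (p1 := 1) (p2 := 0) (p3 := 0) (q1 := 0) (q2 := 1) (q3 := 0)
    (r1 := - (f u w / f u u)) (r2 := - (f v w / f v v)) (r3 := 1) g); rewrite /w';
      try lmod.
  by rewrite (_ : _ + _ = 1) ?oner_neq0 //; ring.
have uw' : f u w' = 0 by rewrite /w' !fE uv; fieldz.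
have w'u : f w' u = 0 by rewrite /w' !fE vu uv wu; fieldz.
have vw' : f v w' = 0 by rewrite /w' !fE vu uv; fieldz.
have w'v : f w' v = 0 by rewrite /w' !fE uv wv; fieldz.
have ww0 : f w' w' != 0.
  by have := nondegenerate gw; rewrite uw' w'u vw' w'v eqxx /= orbF.
clearbody w'.
have root (a : F) : a != 0 -> exists2 s, s * s = a & s != 0.
  move=> a0; have [s es] := sqrtF a; exists s => //.
  by apply: contraNneq a0 => s0; rewrite -es s0 mulr0.
have [[s es s0] [t et t0] [z ez z0]] := And3 (root _ uu0) (root _ vv0) (root _ ww0).
apply: (@gram6 (s^-1 *: u) (t^-1 *: v) (z^-1 *: w')).
  apply: (generates3 (p1 := s^-1) (p2 := 0) (p3 := 0) (q1 := 0) (q2 := t^-1) (q3 := 0)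
    (r1 := 0) (r2 := 0) (r3 := z^-1) gw); try lmod.
  rewrite (_ : _ + _ = s^-1 * t^-1 * z^-1); last by ring.
  by rewrite !mulf_neq0 ?invr_eq0.
rewrite /gram !fE vu uv uw' w'u vw' w'v -es -et -ez.
by do !split; fieldz.
Qed.

Lemma symmetric_one u v w : generates [:: u; v; w] -> symmetric3 u v w ->
  f u u != 0 -> classified A.
Proof.
move=> g [vu wu wv] uu0.
pose v' := v - (f u v / f u u) *: u; pose w' := w - (f u w / f u u) *: u.
have gw : generates [:: u; v'; w'].
  apply: (generates3 (p1 := 1) (p2 := 0) (p3 := 0)
    (q1 := - (f u v / f u u)) (q2 := 1) (q3 := 0)
    (r1 := - (f u w / f u u)) (r2 := 0) (r3 := 1) g); rewrite /v' /w'; try lmod.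
  by rewrite (_ : _ + _ = 1) ?oner_neq0 //; ring.
have uv' : f u v' = 0 by rewrite /v' !fE; fieldz.
have uw' : f u w' = 0 by rewrite /w' !fE; fieldz.
have v'u : f v' u = 0 by rewrite /v' !fE vu; fieldz.
have w'u : f w' u = 0 by rewrite /w' !fE wu; fieldz.
have w'v' : f w' v' = f v' w' by rewrite /v' /w' !fE vu wu wv; ring.
clearbody v' w'.
have [vv|vv] := eqVneq (f v' v') 0; last first.
  by apply: (symmetric_two gw) => //; split; rewrite ?uv' ?uw' ?v'u ?w'u.
have [ww|ww] := eqVneq (f w' w') 0; last first.
  apply: (@symmetric_two u w' v') => //; last by split; rewrite ?uv' ?uw' ?v'u ?w'u.
  by do 2!apply: generates_rot; apply: generates_swap.
have vw0 : f v' w' != 0.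
  by have := nondegenerate gw; rewrite uw' w'u ww w'v' eqxx /= orbb.
apply: (@symmetric_two u (v' + w') w') => //.
- apply: (generates3 (p1 := 1) (p2 := 0) (p3 := 0) (q1 := 0) (q2 := 1) (q3 := 1)
    (r1 := 0) (r2 := 0) (r3 := 1) gw); try lmod.
  by rewrite (_ : _ + _ = 1) ?oner_neq0 //; ring.
- by split; rewrite ?fE ?uv' ?uw' ?v'u ?w'u ?w'v' ?ww //; ring.
- rewrite !fE vv ww w'v' (_ : _ + _ = 2 * f v' w'); last by ring.
  exact: mulf_neq0.
- by rewrite !fE uv' uw' addr0.
Qed.

Lemma symmetric_case u v w : generates [:: u; v; w] -> symmetric3 u v w -> classified A.
Proof.
move=> g [vu wu wv].
have [ww|ww] := eqVneq (f w w) 0; last first.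
  by apply: (@symmetric_one w u v) => //; apply: generates_rot.
have hyperbolic x y : generates [:: x; y; w] -> f x y = f y x -> f w x = f x w ->
    f w y = f y w -> f x w != 0 -> classified A.
  move=> gx yx wx wy xw; have [xx|xx] := eqVneq (f x x) 0; last first.
    exact: symmetric_one gx _ xx.
  apply: (@symmetric_one (x + w) y w).
  - apply: (generates3 (p1 := 1) (p2 := 0) (p3 := 1) (q1 := 0) (q2 := 1) (q3 := 0)
      (r1 := 0) (r2 := 0) (r3 := 1) gx); try lmod.
    by rewrite (_ : _ + _ = 1) ?oner_neq0 //; ring.
  - by split; rewrite ?fE ?yx ?wx ?wy.
  - rewrite !fE xx ww wx (_ : _ + _ = 2 * f x w); last by ring.
    exact: mulf_neq0.
have [uw|uw] := eqVneq (f u w) 0; last exact: (hyperbolic u v).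
have [vw|vw] := eqVneq (f v w) 0; last first.
  by apply: (hyperbolic v u) => //; apply: generates_swap.
by have := nondegenerate g; rewrite uw vw wu wv uw vw ww eqxx.
Qed.

Lemma classify_form u v w : generates [:: u; v; w] -> classified A.
Proof.
move=> g.
have [uv|uv] := eqVneq (f u v) (f v u); last exact: not_symmetric g uv.
have [uw|uw] := eqVneq (f u w) (f w u); last first.
  by apply: (@not_symmetric u w v) => //; do 2!apply: generates_rot;
    apply: generates_swap.
have [vw|vw] := eqVneq (f v w) (f w v); last first.
  by apply: (@not_symmetric v w u) => //; do 2!apply: generates_rot.
exact: symmetric_case g _.
Qed.

End Reductions.
End Forms.

(** * Non-splitness, and the extreme dimensions of the derived algebra *)

Section Existence.
Variables (F : fieldType) (A : leibnizAlg F).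
Hypotheses (two_neq0 : 2 != 0 :> F) (sqrtF : forall a : F, exists b, b * b = a).
Hypotheses (dimA : \dim {:A} = 4%N) (nilA : nilpotent_leibniz A).
Hypothesis nonsplit : ~ split_leibniz A.
Implicit Types (a b u v w x y z : A).

Lemma generates_mem X (U : {vspace A}) :
  generates X -> {subset X <= U} -> (gam A 1 <= U)%VS -> forall a, a \in U.
Proof.
move=> gX XU DU a; apply: (subvP _ a (memvf a)); rewrite -gX subv_add DU andbT.
exact/span_subvP.
Qed.

(** A generator killed on both sides by all generators, and by the derived
    algebra, is central; it would split off. *)
Lemma central_generator w X : generates X ->
    (forall x, x \in X -> x ** w = 0 /\ w ** x = 0) ->
    (forall a, a \in gam A 1 -> a ** w = 0 /\ w ** a = 0) ->
  w \in gam A 1.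
Proof.
move=> gX wX wD; apply/negPn/negP => wN; apply: nonsplit.
apply: (central_split _ wN); first by rewrite dimA.
move=> a.
split; apply/eqP.
  suff : a \in lker (linfun (applyr (brk A) w)) by rewrite memv_ker lfunE.
  apply: (generates_mem gX).
    by move=> x /wX[h _]; rewrite memv_ker lfunE /= /applyr_head h.
  by apply/subvP => x /wD[h _]; rewrite memv_ker lfunE /= /applyr_head h.
suff : a \in lker (linfun (brk A w)) by rewrite memv_ker lfunE.
apply: (generates_mem gX).
  by move=> x /wX[_ h]; rewrite memv_ker lfunE /= h.
by apply/subvP => x /wD[_ h]; rewrite memv_ker lfunE /= h.
Qed.

Lemma generates_drop u X : generates (u :: X) -> u \in gam A 1 -> generates X.
Proof.
move=> g uD; apply: (generatesW g) => x; rewrite inE => /orP[/eqP->|xX].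
  exact: subvP (addvSr _ _) _ uD.
by apply: (subvP (addvSl _ _)); apply: memv_span.
Qed.

Lemma derived_line : \dim (gam A 1) = 1%N -> classified A.
Proof.
move=> d1.
have g2 : gam A 2 = 0%VS.
  have n1 : gam A 1 != 0%VS by rewrite -dimv_eq0 d1.
  by have := dim_gamS nilA n1; rewrite d1 ltnS leqn0 dimv_eq0 => /eqP.
pose x4 := vpick (gam A 1).
have x40 : x4 != 0 by rewrite vpick0 -dimv_eq0 d1.
have D4 : gam A 1 = <[x4]>%VS.
  by apply/eqP; rewrite eq_sym eqEdim -memvE memv_pick dim_vline x40 d1.
have cen a d : d \in gam A 1 -> a ** d = 0 /\ d ** a = 0.
  move=> dD; split; apply/eqP; rewrite -memv0 -g2; first exact: mem_brkv.
  exact: (@brk_gam _ _ 1 0 d a dD (memvf a)).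
have x4D : x4 \in gam A 1 by apply: memv_pick.
pose f a b := coord [tuple x4] ord0 (a ** b).
have brkf a b : a ** b = f a b *: x4.
  have /coord_span : a ** b \in <<[tuple x4]>>%VS by rewrite span_seq1 -D4 gam1E.
  by rewrite big_ord_recl big_ord0 addr0.
have [X] := @exists_generates _ A 3 (ltac:(by rewrite dimA d1)).
case: X => [|u [|v [|w []]]] // _ g.
apply: (@classify_form _ _ two_neq0 sqrtF dimA nilA x4 f brkf _ _ _ _ _ _ _ _ _ _ g).
- by move=> a b c; rewrite /f brkDl linearD.
- by move=> a b c; rewrite /f brkDr linearD.
- by move=> k a b; rewrite /f brkZl linearZ.
- by move=> k a b; rewrite /f brkZr linearZ.
- by move=> a; rewrite /f (cen a x4 x4D).2 linear0.
- by move=> a; rewrite /f (cen a x4 x4D).1 linear0.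
move=> {}u {}v {}w {}g; apply/negPn/negP; rewrite !negb_or !negbK.
move=> /and5P[/eqP wu /eqP wv /eqP ww /eqP uw /eqP vw].
have wD : w \in gam A 1.
  apply: (central_generator g) => [x|a aD]; last by have [-> ->] := cen w a aD.
  by rewrite !inE => /or3P[]/eqP->; rewrite !brkf ?wu ?wv ?ww ?uw ?vw scale0r.
have := size_generates (generates_drop (generates_rot g) wD).
by rewrite dimA d1.
Qed.

(** One generator: its left powers form the basis of the null-filiform
    algebra. *)
Lemma one_generator x1 : generates [:: x1] -> classified A.
Proof.
move=> g; pose x2 := x1 ** x1; pose x3 := x1 ** x2; pose x4 := x1 ** x3.
have l2 a : x2 ** a = 0 by apply: brk_square.
have l3 a : x3 ** a = 0 by rewrite /x3 brk_left !l2 brk0r subrr.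
have l4 a : x4 ** a = 0 by rewrite /x4 brk_left !l3 brk0r subrr.
have r4 : x1 ** x4 = 0.
  apply/eqP; rewrite -memv0 -(@gam_eq0 _ _ nilA 4) ?dimA //.
  by do 3!apply: mem_brkv; apply: gam1E.
exists 7 => //.
apply: (@of_class_generated _ _ dimA nilA 7 0 x1 x2 x3 x4) => //.
  by apply: (generates_subset g) => x; rewrite !inE => ->.
by table4; rewrite ?l2 ?l3 ?l4.
Qed.

End Existence.

(** * Two generators, products of three elements zero *)

Section ClassTwo.
Variables (F : fieldType) (A : leibnizAlg F).
Hypotheses (two_neq0 : 2 != 0 :> F) (sqrtF : forall a : F, exists b, b * b = a).
Hypotheses (dimA : \dim {:A} = 4%N) (nilA : nilpotent_leibniz A).
Hypothesis nonsplit : ~ split_leibniz A.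
Hypotheses (dimD : \dim (gam A 1) = 2%N) (A3 : gam A 2 = 0%VS).
Implicit Types (a b u v w x y z : A).

Lemma mem_eq0 (U : {vspace A}) x : x = 0 -> x \in U.
Proof. by move->; apply: mem0v. Qed.

Lemma brk_central a d : d \in gam A 1 -> a ** d = 0.
Proof. by move=> dD; apply/eqP; rewrite -memv0 -A3; apply: mem_brkv. Qed.

Lemma central_brk a d : d \in gam A 1 -> d ** a = 0.
Proof.
move=> dD; apply/eqP; rewrite -memv0 -A3.
exact: (@brk_gam _ _ 1 0 d a dD (memvf a)).
Qed.

Lemma plane_dichotomy x y z : x \in gam A 1 -> y \in gam A 1 -> z \in gam A 1 ->
  (exists p q, z = p *: x + q *: y) \/
  (exists s t, ((s != 0) || (t != 0)) /\ s *: x + t *: y = 0).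
Proof.
move=> xD yD zD; have [x0|x0] := eqVneq x 0.
  by right; exists 1, 0; rewrite oner_neq0 x0; split=> //; lmod.
have [/vlineP[k ->]|yx] := boolP (y \in <[x]>%VS).
  by right; exists k, (-1); rewrite oppr_eq0 oner_neq0 orbT; split=> //; lmod.
left; have fr : free [:: y; x] by rewrite free_cons span_seq1 yx seq1_free x0.
have /eqP e : (<[y]> + <[x]> == gam A 1)%VS.
  rewrite -(span_seq1 x) -span_cons eqEdim (eqP fr) dimD andbT.
  by apply/span_subvP => t; rewrite !inE => /orP[]/eqP->.
move: zD; rewrite -e => /memv_addP[_ /vlineP[q ->] [_ /vlineP[p ->] ->]].
by exists p, q; rewrite addrC.
Qed.

Lemma plane_relation x y z : x \in gam A 1 -> y \in gam A 1 -> z \in gam A 1 ->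
  exists r s t, [|| r != 0, s != 0 | t != 0] /\ r *: x + s *: y + t *: z = 0.
Proof.
move=> xD yD zD; have [[p [q ->]]|[s [t [st e]]]] := plane_dichotomy xD yD zD.
  by exists p, q, (-1); rewrite oppr_eq0 oner_neq0 !orbT; split=> //; lmod.
by exists s, t, 0; rewrite e scale0r addr0 orbA st; split.
Qed.

Lemma classified_two k c u v x3 x4 : (1 <= k <= 25)%N -> admissible k c ->
    (forall i j, (2 < i)%N || (2 < j)%N -> leibniz_product k c u v x3 x4 i j = 0) ->
    generates [:: u; v] -> x3 \in gam A 1 -> x4 \in gam A 1 ->
    u ** u = leibniz_product k c u v x3 x4 1 1 ->
    u ** v = leibniz_product k c u v x3 x4 1 2 ->
    v ** u = leibniz_product k c u v x3 x4 2 1 ->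
    v ** v = leibniz_product k c u v x3 x4 2 2 ->
  classified A.
Proof.
move=> hk adm lp0 g h3 h4 uu uv vu vv; exists k => //.
apply: (@of_class_generated _ _ dimA nilA k c u v x3 x4 adm).
  by apply: (generates_subset g) => x; rewrite !inE => /orP[]->; rewrite ?orbT.
by table4; first [done | rewrite lp0 //;
  first [exact: brk_central | exact: central_brk]].
Qed.

Ltac lp_zero :=
  case=> [|[|[|[|[|?]]]]]; case=> [|[|[|[|[|?]]]]] //=.

(** With [v,v] = 0, all squares are combinations of [u,u] and
    z = [u,v] + [v,u]. If [u,v] = a[u,u] + bz, the table depends on a and b only;
    otherwise squares lie in a line, and the quadratic form they define has rank
    one or two. *)
Lemma isotropic_generator u v : generates [:: u; v] -> v ** v = 0 -> classified A.
Proof.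
move=> g vv.
have [] := plane_dichotomy (gam1E u u) (rpredD (gam1E u v) (gam1E v u)) (gam1E u v).
  move=> [a [b euv]]; set z := u ** v + v ** u in euv.
  have evu : v ** u = - a *: (u ** u) + (1 - b) *: z.
    by rewrite -[v ** u](addKr (u ** v)) -/z {1}euv; lmod.
  have [a0|a0] := eqVneq a 0.
    rewrite a0 in euv evu.
    have [b0|b0] := eqVneq b 0.
      apply: (@classified_two 15 0 u v (u ** u) (v ** u)); rewrite ?gam1E //;
        first by lp_zero.
      by rewrite euv b0 /=; lmod.
    have [b1|b1] := eqVneq b 1.
      apply: (@classified_two 14 0 u v (u ** u) (u ** v)); rewrite ?gam1E //;
        first by lp_zero.
      by rewrite evu b1 /=; lmod.
    apply: (@classified_two 17 ((1 - b) / b) u v (u ** u) (u ** v)); rewrite ?gam1E //.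
    - split=> /eqP;
        last by rewrite mulf_eq0 invr_eq0 (negPf b0) orbF subr_eq0 eq_sym (negPf b1).
      rewrite -[-1](mulfK b0) (inj_eq (mulIf _)) ?invr_eq0 // mulN1r.
      by rewrite subr_eq addNr oner_eq0.
    - by lp_zero.
    - by rewrite evu euv /=; lmod; fieldz.
  apply: (@classified_two 16 0 (- a^-1 *: v) (u + (b / a) *: v)
    ((u + (b / a) *: v) ** (- a^-1 *: v)) ((- a^-1 *: v) ** (u + (b / a) *: v)));
    rewrite ?gam1E //; first by lp_zero.
  - apply: (generates2 (p := 0) (q := - a^-1) (r := 1) (s := b / a) g).
    + by rewrite mul0r add0r mulr1 opprK invr_eq0.
    + by apply: mem_eq0; lmod.
    + by apply: mem_eq0; lmod.
  - by rewrite !brkE vv /=; lmod.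
  - by rewrite /= !brkE vv euv evu; lmod; fieldz.
set z := u ** v + v ** u => -[s [t [st e]]].
have [i i2] := sqrtF (-1).
have [s0|s0] := eqVneq s 0.
  have z0 : z = 0.
    move: st e; rewrite s0 eqxx /= => t0 /eqP.
    by rewrite scale0r add0r scaler_eq0 (negPf t0) => /eqP.
  apply: (@classified_two 8 0 u v (u ** v) (u ** u)); rewrite ?gam1E //;
    first by lp_zero.
  by apply/eqP; rewrite /= -addr_eq0 addrC -/z z0.
pose u' := u + (t / s) *: v.
have uu' : u' ** u' = 0.
  rewrite /u' !brkE vv; transitivity (s^-1 *: (s *: (u ** u) + t *: z)).
    by rewrite /z; lmod; fieldz.
  by rewrite e scaler0.
have g' : generates [:: u'; v].
  apply: (generates2 (p := 1) (q := t / s) (r := 0) (s := 1) g).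
  - by rewrite mulr1 mulr0 subr0 oner_neq0.
  - by apply: mem_eq0; rewrite /u'; lmod.
  - by apply: mem_eq0; lmod.
clearbody u'; clear e z.
have i0 : i != 0.
  by apply/eqP => i0; move/eqP: i2; rewrite i0 mulr0 eq_sym oppr_eq0 oner_eq0.
apply: (@classified_two 9 0 (u' + v) (i *: (u' - v)) ((u' + v) ** (i *: (u' - v)))
   ((u' + v) ** (u' + v))); rewrite ?gam1E //; first by lp_zero.
- apply: (generates2 (p := 1) (q := 1) (r := i) (s := - i) g').
  + by rewrite (_ : _ - _ = - (2 * i)) ?oppr_eq0 ?mulf_neq0 //; ring.
  + by apply: mem_eq0; lmod.
  + by apply: mem_eq0; lmod.
- by rewrite /= !brkE uu' vv; lmod.
- by rewrite /= !brkE uu' vv; lmod; (transitivity (- (i * i)); [ring | rewrite i2;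
    ring]).
Qed.

(** The generators of the target tables are found from the pairs with zero
    product: for s different from zero there are two lines of left factors,
    those of u + v and (s-1)u - (s+1)v; for s = 0 they coincide and an extra
    square root of -1 is needed. *)
Lemma orthogonal_normal u v s : generates [:: u; v] ->
    u ** v = - ((s - 1) / 2) *: (u ** u) - ((s + 1) / 2) *: (v ** v) ->
    v ** u = - (u ** v) ->
  classified A.
Proof.
move=> g uv vu; rewrite uv in vu.
have [s0|s0] := eqVneq s 0.
  rewrite s0 in uv vu; have [i i2] := sqrtF (-1).
  have i0 : i != 0.
    by apply/eqP => i0; move/eqP: i2; rewrite i0 mulr0 eq_sym oppr_eq0 oner_eq0.
  apply: (@classified_two 19 0 (u + v) ((1 + i) *: u + (1 - i) *: v)
    (u ** u + v ** v) ((2 * i) *: (u ** u - v ** v))).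
  - by [].
  - by [].
  - by lp_zero.
  - apply: (generates2 (p := 1) (q := 1) (r := 1 + i) (s := 1 - i) g).
    + by rewrite (_ : _ - _ = - (2 * i)) ?oppr_eq0 ?mulf_neq0 //; ring.
    + by apply: mem_eq0; lmod.
    + by apply: mem_eq0; lmod.
  - by rewrite rpredD ?gam1E.
  - by rewrite rpredZ // rpredB ?gam1E.
  - by rewrite /= !brkE uv vu; lmod; fieldz.
  - by rewrite /= !brkE uv vu; lmod; fieldz.
  - by rewrite /= !brkE uv vu; lmod; fieldz.
  - have e : (1 + i) * (1 + i) = 2 * i by transitivity (1 + 2 * i + i * i);
      [ring | rewrite i2; ring].
    have e' : (1 - i) * (1 - i) = - (2 * i) by transitivity (1 - 2 * i + i * i);
      [ring | rewrite i2; ring].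
    have e2 : (1 - i) * (1 + i) = 2 by transitivity (1 - i * i); [ring | rewrite i2;
      ring].
    transitivity (((1 + i) * (1 + i)) *: (u ** u) + ((1 - i) * (1 - i)) *: (v ** v)).
      by rewrite /= !brkE uv vu; lmod; fieldz.
    by rewrite e e' /=; lmod.
pose x1 := u + v; pose x2 := (s - 1) *: u - (s + 1) *: v.
apply: (@classified_two 18 (s * s - 1) x1 x2 (x1 ** x1) (x2 ** x1)); rewrite ?gam1E //.
- move=> /eqP; rewrite -subr_eq0 opprK subrK mulf_eq0 orbb.
  exact/negP.
- by lp_zero.
- apply: (generates2 (p := 1) (q := 1) (r := s - 1) (s := - (s + 1)) g).
  + by rewrite (_ : 1 * - (s + 1) - 1 * (s - 1) = - (2 * s)) ?oppr_eq0 ?mulf_neq0 //;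
      ring.
  + by apply: mem_eq0; rewrite /x1; lmod.
  + by apply: mem_eq0; rewrite /x2; lmod.
- by rewrite /x1 /x2 /= !brkE uv vu; lmod; fieldz.
- by rewrite /x1 /x2 /= !brkE uv vu; lmod; fieldz.
Qed.

(** Rescaling u multiplies p by 1/k and q by k, so that pq is invariant and q can
    be prescribed. The square root s of 1 + 4pq is chosen different from -1, to
    make the prescribed value -(s+1)/2 nonzero. *)
Lemma orthogonal_nonsplit u v p q : generates [:: u; v] -> q != 0 ->
    u ** v = p *: (u ** u) + q *: (v ** v) -> v ** u = - (u ** v) ->
  classified A.
Proof.
move=> g q0 uv vu.
have [s es s1] : exists2 s, s * s = 1 + 4 * (p * q) & s + 1 != 0.
  have [s es] := sqrtF (1 + 4 * (p * q)).
  have [sN1|sN1] := eqVneq (s + 1) 0; last by exists s.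
  have {}sN1 : s = -1 by apply/eqP; rewrite -addr_eq0 sN1.
  by exists 1; rewrite // -es sN1; ring.
pose k := - ((s + 1) / (2 * q)).
have k0 : k != 0 by rewrite oppr_eq0 mulf_neq0 ?invr_eq0 ?mulf_neq0.
have ep : p = (s * s - 1) / (2 * (2 * q)).
  by rewrite es; fieldz.
apply: (@orthogonal_normal (k *: u) v s).
- apply: (generates2 (p := k) (q := 0) (r := 0) (s := 1) g).
  + by rewrite mulr1 mulr0 subr0.
  + by apply: mem_eq0; lmod.
  + by apply: mem_eq0; lmod.
- by rewrite !brkE uv ep; lmod; rewrite /k; fieldz.
- by rewrite !brkE vu scalerN.
Qed.

(** If [u,v] is not a combination of [u,u] and [v,v], then these two squares are
    proportional. If it is zero, the algebra is the direct sum of the ideals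
    generated by u and by v. *)
Lemma orthogonal_generators u v : generates [:: u; v] ->
  u ** v + v ** u = 0 -> classified A.
Proof.
move=> g /eqP; rewrite addrC addr_eq0 => /eqP vu.
have g' : generates [:: v; u].
  by apply: (generates_subset g) => x; rewrite !inE orbC.
have [[p [q uv]]|[s [t [st e]]]] := plane_dichotomy (gam1E u u) (gam1E v v) (gam1E u v).
  have [q0|q0] := eqVneq q 0; last exact: orthogonal_nonsplit g q0 uv vu.
  have [p0|p0] := eqVneq p 0; last first.
    apply: (@orthogonal_nonsplit v u (- q) (- p) g'); rewrite ?oppr_eq0 //.
      by rewrite vu uv; lmod.
    by rewrite vu opprK.
  have uv0 : u ** v = 0 by rewrite uv p0 q0; lmod.
  have vu0 : v ** u = 0 by rewrite vu uv0 oppr0.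
  case: nonsplit; apply: (@orthogonal_pair_split _ _ u v dimA _ _ uv0 vu0).
    rewrite -span_cat /=; apply: (generating_subalgebra nilA).
      apply: brk_span => a b; rewrite !inE => /or4P[]/eqP-> /or4P[]/eqP->;
      rewrite ?(brk_central _ (gam1E _ _)) ?(central_brk _ (gam1E _ _)) ?uv0 ?vu0 ?mem0v //;
      by rewrite memv_span // !inE eqxx ?orbT.
    by apply: (generates_subset g) => x; rewrite !inE => /orP[]->; rewrite ?orbT.
  by move=> a b c; split; [apply: brk_central | apply: central_brk]; apply: gam1E.
have [s0|s0] := eqVneq s 0.
  apply: (isotropic_generator g); move: st e; rewrite s0 eqxx /= => t0 /eqP.
  by rewrite scale0r add0r scaler_eq0 (negPf t0) => /eqP.
have uu : u ** u = (- t / s) *: (v ** v).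
  transitivity (s^-1 *: (s *: (u ** u) + t *: (v ** v)) - (t / s) *: (v ** v)).
    by lmod; fieldz.
  by rewrite e; lmod.
have [d ed] := sqrtF (- t / s).
have [d0|d0] := eqVneq d 0.
  by apply: (isotropic_generator g'); rewrite uu -ed d0 mulr0 scale0r.
apply: (@classified_two 9 0 u (d *: v) (u ** (d *: v)) (u ** u)); rewrite ?gam1E //.
- by lp_zero.
- apply: (generates2 (p := 1) (q := 0) (r := 0) (s := d) g).
  + by rewrite mul1r mul0r subr0.
  + by apply: mem_eq0; lmod.
  + by apply: mem_eq0; lmod.
- by rewrite /= !brkE vu scalerN.
- by rewrite /= !brkE scalerA ed uu.
Qed.

(** The three values of the quadratic map a |-> [a,a] on a pair of generators
    are linearly dependent. Completing the square in the relation produces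
    either an isotropic generator or an orthogonal pair. *)
Lemma class_two : classified A.
Proof.
have [X] := @exists_generates _ A 2 (ltac:(by rewrite dimA dimD)).
case: X => [|u [|v []]] // _ g.
have claim x y r s t : generates [:: x; y] -> r != 0 ->
    r *: (x ** x) + s *: (x ** y + y ** x) + t *: (y ** y) = 0 -> classified A.
  move=> gx r0 e; pose x' := x + (s / r) *: y; pose d := (s * s - r * t) / (r * r).
  have xx' : x' ** x' = d *: (y ** y).
    rewrite /x' /d !brkE; transitivity
      (r^-1 *: (r *: (x ** x) + s *: (x ** y + y ** x) + t *: (y ** y))
       + ((s * s - r * t) / (r * r)) *: (y ** y)); first by lmod; fieldz.
    by rewrite e; lmod.
  have gx' : generates [:: x'; y].
    apply: (generates2 (p := 1) (q := s / r) (r := 0) (s := 1) gx).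
    - by rewrite mulr1 mulr0 subr0 oner_neq0.
    - by apply: mem_eq0; rewrite /x'; lmod.
    - by apply: mem_eq0; lmod.
  clearbody x' d; have [k ek] := sqrtF d.
  have [k0|k0] := eqVneq k 0.
    apply: (@isotropic_generator y x'); last by rewrite xx' -ek k0 mulr0 scale0r.
    by apply: (generates_subset gx') => z; rewrite !inE orbC.
  apply: (@orthogonal_generators (x' + k *: y) (x' - k *: y)).
    apply: (generates2 (p := 1) (q := k) (r := 1) (s := - k) gx').
    - by rewrite (_ : _ - _ = - (2 * k)) ?oppr_eq0 ?mulf_neq0 //; ring.
    - by apply: mem_eq0; lmod.
    - by apply: mem_eq0; lmod.
  by rewrite !brkE xx' -ek; lmod.
have [r [s [t [rst e]]]] := plane_relation (gam1E u u)
  (rpredD (gam1E u v) (gam1E v u)) (gam1E v v).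
have [r0|r0] := eqVneq r 0; last exact: claim g r0 e.
have [t0|t0] := eqVneq t 0; last first.
  apply: (claim v u t s r) => //; first by apply: (generates_subset g) => z;
    rewrite !inE orbC.
  by rewrite -e; lmod.
apply: (orthogonal_generators g); move: rst e; rewrite r0 t0 eqxx orbF /= => s0.
by rewrite !scale0r add0r addr0 => /eqP; rewrite scaler_eq0 (negPf s0) => /eqP.
Qed.

End ClassTwo.

(** * Two generators, products of three elements spanning a line *)

Section ClassThree.
Variables (F : fieldType) (A : leibnizAlg F).
Hypotheses (two_neq0 : 2 != 0 :> F) (sqrtF : forall a : F, exists b, b * b = a).
Hypotheses (dimA : \dim {:A} = 4%N) (nilA : nilpotent_leibniz A).
Hypothesis nonsplit : ~ split_leibniz A.
Hypothesis nonlie : exists a : A, a ** a != 0.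
Hypotheses (dimD : \dim (gam A 1) = 2%N) (dimD2 : \dim (gam A 2) = 1%N).
Implicit Types (a b u v w x y z : A).

Lemma gam3_0 : gam A 3 = 0%VS.
Proof.
have n2 : gam A 2 != 0%VS by rewrite -dimv_eq0 dimD2.
by have := dim_gamS nilA n2; rewrite dimD2 ltnS leqn0 dimv_eq0 => /eqP.
Qed.

Lemma gam3_eq0 z : z \in gam A 3 -> z = 0.
Proof. by rewrite gam3_0 memv0 => /eqP. Qed.

Lemma brk_deep a z : z \in gam A 2 -> a ** z = 0.
Proof. by move=> zD; apply: gam3_eq0; apply: mem_brkv. Qed.

Lemma deep_brk a z : z \in gam A 2 -> z ** a = 0.
Proof. by move=> zD; apply: gam3_eq0; apply: (@brk_gam _ _ 2 0 z a zD (memvf a)). Qed.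

Lemma derived_brk x y : x \in gam A 1 -> y \in gam A 1 -> x ** y = 0.
Proof. by move=> xD yD; apply: gam3_eq0; apply: (@brk_gam _ _ 1 1). Qed.

Lemma classified_three k c u v x3 x4 : (1 <= k <= 25)%N -> admissible k c ->
    leibniz_product k c u v x3 x4 3 3 = 0 ->
    (forall i j, (i == 4%N) || (j == 4%N) -> leibniz_product k c u v x3 x4 i j = 0) ->
    generates [:: u; v] -> x3 \in gam A 1 -> x4 \in gam A 2 ->
    [/\ u ** u = leibniz_product k c u v x3 x4 1 1,
        u ** v = leibniz_product k c u v x3 x4 1 2,
        v ** u = leibniz_product k c u v x3 x4 2 1 &
        v ** v = leibniz_product k c u v x3 x4 2 2] ->
    [/\ u ** x3 = leibniz_product k c u v x3 x4 1 3,
        v ** x3 = leibniz_product k c u v x3 x4 2 3,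
        x3 ** u = leibniz_product k c u v x3 x4 3 1 &
        x3 ** v = leibniz_product k c u v x3 x4 3 2] ->
  classified A.
Proof.
move=> hk adm lp33 lp4 g h3 h4 [uu uv vu vv] [u3 v3 w3 z3]; exists k => //.
apply: (@of_class_generated _ _ dimA nilA k c u v x3 x4 adm).
  by apply: (generates_subset g) => x; rewrite !inE => /orP[]->; rewrite ?orbT.
table4; first [done | by rewrite lp33 derived_brk | rewrite lp4 //].
all: by [exact: brk_deep | exact: deep_brk].
Qed.

Ltac lp_zero4 :=
  case=> [|[|[|[|[|?]]]]]; case=> [|[|[|[|[|?]]]]] //=.

Lemma generates_scale u v (s t : F) : generates [:: u; v] -> s != 0 -> t != 0 ->
  generates [:: s *: u; t *: v].
Proof.
move=> g s0 t0; apply: (generates2 (p := s) (q := 0) (r := 0) (s := t) g).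
- by rewrite mulr0 subr0 mulf_neq0.
- by apply: mem_eq0; lmod.
- by apply: mem_eq0; lmod.
Qed.

(** Left multiplication by u carries v to x3 and x3 to x4, while x3 is killed from
    the left by v and kills everything from the left. Replacing u by u - a x3 kills [u,u];
    then b and c are only rescaled, and each can be made 0 or 1. *)
Lemma left_null_chain u v x3 x4 (a b c : F) : generates [:: u; v] ->
    x3 \in gam A 1 -> x4 \in gam A 2 -> (forall y, x3 ** y = 0) ->
    u ** v = x3 -> u ** x3 = x4 -> v ** x3 = 0 ->
    u ** u = a *: x4 -> v ** u = c *: x4 -> v ** v = b *: x4 ->
  classified A.
Proof.
move=> g h3 h4 l3 uv u3 v3 uu vu vv; pose u' := u - a *: x3.
have g' : generates [:: u'; v].
  apply: (generates2 (p := 1) (q := 0) (r := 0) (s := 1) g).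
  - by rewrite mulr0 mulr1 subr0 oner_neq0.
  - rewrite (_ : u' - _ = - a *: x3); first exact: rpredZ.
    by rewrite /u'; lmod.
  - by apply: mem_eq0; lmod.
have uu' : u' ** u' = 0 by rewrite /u' !brkE uu u3 !l3; lmod.
have uv' : u' ** v = x3 by rewrite /u' !brkE uv l3; lmod.
have vu' : v ** u' = c *: x4 by rewrite /u' !brkE vu v3; lmod.
have u3' : u' ** x3 = x4 by rewrite /u' !brkE u3 l3; lmod.
clearbody u'.
have scaled s t k : s != 0 -> t != 0 -> (20 <= k <= 23)%N ->
    (s * t * c) *: x4 = leibniz_product k 0 (s *: u') (t *: v)
      ((s * t) *: x3) ((s * s * t) *: x4) 2 1 ->
    (t * t * b) *: x4 = leibniz_product k 0 (s *: u') (t *: v)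
      ((s * t) *: x3) ((s * s * t) *: x4) 2 2 -> classified A.
  move=> s0 t0 hk e21 e22.
  have {hk} hk : k = 20 \/ k = 21 \/ k = 22 \/ k = 23 by lia.
  apply: (@classified_three k 0 (s *: u') (t *: v) ((s * t) *: x3) ((s * s * t) *: x4)).
  - by case: hk => [->|[->|[->|->]]].
  - by case: hk => [->|[->|[->|->]]].
  - by case: hk => [->|[->|[->|->]]].
  - by case: hk => [->|[->|[->|->]]]; lp_zero4.
  - exact: generates_scale.
  - exact: rpredZ.
  - exact: rpredZ.
  - rewrite !brkE uu' uv' vu' vv -e21 -e22.
    by case: hk => [->|[->|[->|->]]]; split=> /=; lmod.
  - rewrite !brkE u3' v3 !l3.
    by case: hk => [->|[->|[->|->]]]; split=> /=; lmod.
have one0 := oner_neq0 F.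
have [c0|c0] := eqVneq c 0; have [b0|b0] := eqVneq b 0.
- by apply: (scaled 1 1 20) => //=; rewrite ?c0 ?b0; lmod.
- by apply: (scaled 1 b^-1 21); rewrite ?invr_eq0 //= ?c0; lmod; fieldz.
- by apply: (scaled c 1 22) => //=; rewrite ?b0; lmod.
- apply: (scaled c (c * c / b) 23); rewrite ?mulf_neq0 ?invr_eq0 //=; lmod; fieldz.
Qed.

(** The chain starts at u itself. Replacing v by v - a x3 kills [u,v]; the value b
    is then decisive: if it is nonzero, c is removed by adding a multiple of v to
    u, and if b = c = 0 then v would be a central generator. *)
Lemma square_chain u v x3 x4 (a b c : F) : generates [:: u; v] ->
    gam A 1 = (<[x3]> + <[x4]>)%VS -> x4 \in gam A 2 -> (forall y, x3 ** y = 0) ->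
    u ** u = x3 -> u ** x3 = x4 -> v ** x3 = 0 ->
    u ** v = a *: x4 -> v ** u = c *: x4 -> v ** v = b *: x4 ->
  classified A.
Proof.
move=> g D34 h4 l3 uu u3 v3 uv vu vv; pose v' := v - a *: x3.
have h3 : x3 \in gam A 1 by rewrite D34 (subvP (addvSl _ _)) ?memv_line.
have g' : generates [:: u; v'].
  apply: (generates2 (p := 1) (q := 0) (r := 0) (s := 1) g).
  - by rewrite mulr0 mulr1 subr0 oner_neq0.
  - by apply: mem_eq0; lmod.
  - rewrite (_ : v' - _ = - a *: x3); first exact: rpredZ.
    by rewrite /v'; lmod.
have uv' : u ** v' = 0 by rewrite /v' !brkE uv u3; lmod.
have vu' : v' ** u = c *: x4 by rewrite /v' !brkE vu l3; lmod.
have vv' : v' ** v' = b *: x4 by rewrite /v' !brkE vv v3 !l3; lmod.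
have v3' : v' ** x3 = 0 by rewrite /v' !brkE v3 l3; lmod.
clearbody v'.
have [b0|b0] := eqVneq b 0; last first.
  have [r er] := sqrtF b.
  have r0 : r != 0 by apply: contraNneq b0 => r0; rewrite -er r0 mulr0.
  apply: (@classified_three 25 0 (u - (c / b) *: v') (r^-1 *: (v' + c *: x3)) x3 x4) => //.
  - by lp_zero4.
  - apply: (generates2 (p := 1) (q := - (c / b)) (r := 0) (s := r^-1) g').
    + by rewrite mul1r mulr0 subr0 invr_eq0.
    + by apply: mem_eq0; lmod.
    + rewrite (_ : _ - _ = (r^-1 * c) *: x3); last by lmod.
      exact: rpredZ.
  - split; rewrite ?brkE ?uu ?uv' ?vu' ?vv' ?v3' ?u3 ?l3 /=; lmod; try by fieldz.
    by rewrite -er; fieldz.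
  - by split; rewrite ?brkE ?u3 ?v3' ?l3 /=; lmod.
rewrite b0 scale0r in vv'.
have [c0|c0] := eqVneq c 0; last first.
  apply: (@classified_three 24 0 u (c^-1 *: v') x3 x4) => //.
  - by lp_zero4.
  - have := generates_scale g' (oner_neq0 F) (invr_neq0 c0).
    by rewrite scale1r.
  - by split; rewrite ?brkE ?uu ?uv' ?vu' ?vv' /=; lmod; fieldz.
  - by split; rewrite ?brkE ?u3 ?v3' ?l3 /=; lmod.
apply: (@one_generator _ _ dimA nilA u).
have vD : v' \in gam A 1.
  apply: (central_generator dimA nonsplit g') => [x|x].
    by rewrite !inE => /orP[]/eqP->; rewrite ?uv' ?vu' ?vv' ?c0 ?scale0r.
  rewrite D34 => /memv_addP[_ /vlineP[k ->] [_ /vlineP[l ->] ->]].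
  by rewrite !brkE l3 v3' (brk_deep _ h4) (deep_brk _ h4); split; lmod.
apply: (@generates_drop _ _ v') vD.
by apply: (generates_subset g') => x; rewrite !inE orbC.
Qed.

(** The product is alternating up to the squares, which form a binary quadratic
    form with coefficients a, c, b on u and v. Admissible changes of generators
    preserve the line of v modulo the derived algebra, so the orbits are separated
    by the rank of that form and by whether it vanishes at v. *)
Lemma skew_chain u v x3 x4 (a b c : F) : generates [:: u; v] ->
    gam A 1 = (<[x3]> + <[x4]>)%VS -> x4 \in gam A 2 ->
    u ** v = x3 -> u ** x3 = x4 -> v ** x3 = 0 -> x3 ** u = - x4 -> x3 ** v = 0 ->
    u ** u = a *: x4 -> v ** u = - x3 + c *: x4 -> v ** v = b *: x4 ->
  classified A.
Proof.
move=> g D34 h4 uv u3 v3 l3 z3 uu vu vv.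
have h3 : x3 \in gam A 1 by rewrite D34 (subvP (addvSl _ _)) ?memv_line.
have [b0|b0] := eqVneq b 0; last first.
  have [t et] := quadratic_root two_neq0 sqrtF c a b0.
  pose u' := u + t *: v; pose x3' := x3 + (t * b) *: x4; pose c' := c + 2 * t * b.
  have g' : generates [:: u'; v].
    apply: (generates2 (p := 1) (q := t) (r := 0) (s := 1) g).
    - by rewrite mulr0 mulr1 subr0 oner_neq0.
    - by apply: mem_eq0; rewrite /u'; lmod.
    - by apply: mem_eq0; lmod.
  have uu' : u' ** u' = 0.
    rewrite /u' !brkE uu uv vu vv; transitivity ((b * (t * t) + c * t + a) *: x4).
      by lmod.
    by rewrite et scale0r.
  have uv' : u' ** v = x3' by rewrite /u' !brkE uv vv /x3'; lmod.
  have vu' : v ** u' = - x3' + c' *: x4 by rewrite /u' !brkE vu vv /x3' /c'; lmod.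
  have h3' : x3' \in gam A 1.
    by rewrite rpredD // rpredZ // (subvP (gamS A 1)).
  have u3' : u' ** x3' = x4.
    by rewrite /u' /x3' !brkE u3 v3 !(brk_deep _ h4); lmod.
  have v3' : v ** x3' = 0 by rewrite /x3' !brkE v3 (brk_deep _ h4); lmod.
  have l3' : x3' ** u' = - x4.
    by rewrite /u' /x3' !brkE l3 z3 !(deep_brk _ h4); lmod.
  have z3' : x3' ** v = 0 by rewrite /x3' !brkE z3 (deep_brk _ h4); lmod.
  clearbody u' x3' c'.
  have [c0|c0] := eqVneq c' 0.
    apply: (@classified_three 11 0 u' (b^-1 *: v) (b^-1 *: x3') (b^-1 *: x4)) => //.
    - by lp_zero4.
    - by have := generates_scale g' (oner_neq0 F) (invr_neq0 b0); rewrite scale1r.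
    - exact: rpredZ.
    - exact: rpredZ.
    - by split; rewrite ?brkE ?uu' ?uv' ?vu' ?vv ?c0 /=; lmod; fieldz.
    - by split; rewrite ?brkE ?u3' ?v3' ?l3' ?z3' /=; lmod.
  pose t' := c' * c' / b.
  have t0 : t' != 0 by rewrite !mulf_neq0 ?invr_eq0.
  apply: (@classified_three 13 0 (c' *: u') (t' *: v) ((c' * t') *: x3')
    ((c' * c' * t') *: x4)) => //.
  - by lp_zero4.
  - exact: generates_scale.
  - exact: rpredZ.
  - exact: rpredZ.
  - by split; rewrite ?brkE ?uu' ?uv' ?vu' ?vv /=; lmod; rewrite /t'; fieldz.
  - by split; rewrite ?brkE ?u3' ?v3' ?l3' ?z3' /=; lmod.
rewrite b0 scale0r in vv.
have [c0|c0] := eqVneq c 0; last first.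
  pose t := (1 - a) / c.
  apply: (@classified_three 12 0 (c *: (u + t *: v)) v (c *: x3) ((c * c) *: x4)) => //.
  - by lp_zero4.
  - apply: (generates2 (p := c) (q := c * t) (r := 0) (s := 1) g).
    + by rewrite mulr0 mulr1 subr0.
    + by apply: mem_eq0; lmod.
    + by apply: mem_eq0; lmod.
  - exact: rpredZ.
  - exact: rpredZ.
  - by split; rewrite ?brkE ?uu ?uv ?vu ?vv /=; lmod; rewrite /t; fieldz.
  - by split; rewrite ?brkE ?u3 ?v3 ?l3 ?z3 /=; lmod.
rewrite c0 scale0r addr0 in vu.
have [a0|a0] := eqVneq a 0; last first.
  apply: (@classified_three 10 0 u (a *: v) (a *: x3) (a *: x4)) => //.
  - by lp_zero4.
  - by have := generates_scale g (oner_neq0 F) a0; rewrite scale1r.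
  - exact: rpredZ.
  - exact: rpredZ.
  - by split; rewrite ?brkE ?uu ?uv ?vu ?vv /=; lmod.
  - by split; rewrite ?brkE ?u3 ?v3 ?l3 ?z3 /=; lmod.
(* all squares vanish, so the algebra would be a Lie algebra *)
rewrite a0 scale0r in uu.
case: nonlie => x /eqP[].
have : x \in (<<[:: u; v]>> + gam A 1)%VS by rewrite g memvf.
rewrite D34 span_cons span_seq1 => /memv_addP[_ /memv_addP[_ /vlineP[p ->]
  [_ /vlineP[q ->] ->]] [_ /memv_addP[_ /vlineP[k ->] [_ /vlineP[l ->] ->]] ->]].
rewrite !brkE uu uv vu vv u3 v3 l3 z3 !(brk_deep _ h4) !(deep_brk _ h4).
by rewrite (derived_brk h3 h3); lmod.
Qed.

Lemma line_sum_change x y (p q r : F) : p != 0 -> r != 0 ->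
  (<[p *: x + q *: y]> + <[r *: y]> = <[x]> + <[y]>)%VS.
Proof.
move=> p0 r0.
have xS : x \in (<[x]> + <[y]>)%VS by rewrite (subvP (addvSl _ _)) ?memv_line.
have yS : y \in (<[x]> + <[y]>)%VS by rewrite (subvP (addvSr _ _)) ?memv_line.
have x'S : p *: x + q *: y \in (<[p *: x + q *: y]> + <[r *: y]>)%VS.
  by rewrite (subvP (addvSl _ _)) ?memv_line.
have y'S : r *: y \in (<[p *: x + q *: y]> + <[r *: y]>)%VS.
  by rewrite (subvP (addvSr _ _)) ?memv_line.
apply/eqP; rewrite eqEsubv !subv_add -!memvE.
rewrite rpredD ?rpredZ //=; apply/andP; split.
  rewrite {1}(_ : x = p^-1 *: ((p *: x + q *: y) - (q / r) *: (r *: y))).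
    by rewrite rpredZ // rpredB // rpredZ.
  by lmod; fieldz.
rewrite {1}(_ : y = r^-1 *: (r *: y)); first by rewrite rpredZ.
by lmod; fieldz.
Qed.

(** The derived algebra is spanned by x3 and x4 = [u,x3]. With f_ij and b_j the
    coefficients of the products of generators on x3 and of [x3,u], [x3,v] on x4,
    the Leibniz identity gives f_2j = f_12 b_j, and enough further relations to
    force either b = 0, or b = (-1, 0) with f alternating. *)
Lemma class_three : classified A.
Proof.
have [x3 h3 n3] : exists2 x3, x3 \in gam A 1 & x3 \notin gam A 2.
  apply/subvPn; apply/negP => /dimvS; by rewrite dimD dimD2.
have x30 : x3 != 0 by apply: contraNneq n3 => ->; apply: mem0v.
have D3 : gam A 1 = (<[x3]> + gam A 2)%VS.
  apply/eqP; rewrite eq_sym eqEdim subv_add -memvE h3 gamS dimD /=.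
  have /dimv_disjoint_sum -> : (<[x3]> :&: gam A 2 = 0)%VS.
    apply/eqP; rewrite -subv0; apply/subvP => y /memv_capP[/vlineP[k ->] kD].
    rewrite memv0 scaler_eq0; apply: contraNT n3; rewrite negb_or => /andP[k0 _].
    by rewrite -[x3]scale1r -(mulVf k0) -scalerA rpredZ.
  by rewrite dim_vline x30 dimD2.
have [X] := @exists_generates _ A 2 (ltac:(by rewrite dimA dimD)).
case: X => [|u [|v []]] // _.
wlog u3 : u v / u ** x3 != 0.
  move=> wl g; have [u3|u3] := eqVneq (u ** x3) 0; last exact: wl u3 g.
  have g' : generates [:: v; u] by apply: (generates_subset g) => x; rewrite !inE orbC.
  have [v3|v3] := eqVneq (v ** x3) 0; last exact: wl v3 g'.
  suff : (gam A 2 <= 0)%VS by rewrite subv0 -dimv_eq0 dimD2.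
  apply: brkv_sub => a b bD; have : b \in gam A 1 by [];
    rewrite D3 => /memv_addP[_ /vlineP[k ->] [z zD ->]].
  rewrite brkDr brkZr (brk_deep _ zD) addr0 rpredZ // memv0.
  suff : a \in lker (linfun (applyr (brk A) x3)) by rewrite memv_ker lfunE.
  apply: (generates_mem g) => [x|].
    by rewrite !inE => /orP[]/eqP->; rewrite memv_ker lfunE /= /applyr_head ?u3 ?v3.
  by apply/subvP => x xD; rewrite memv_ker lfunE /= /applyr_head derived_brk.
set x4 := u ** x3 in u3 => g0.
have h4 : x4 \in gam A 2 by apply: mem_brkv.
have D4 : gam A 2 = <[x4]>%VS.
  by apply/eqP; rewrite eq_sym eqEdim -memvE h4 dim_vline u3 dimD2.
have line z : z \in gam A 2 -> exists k, z = k *: x4 by rewrite D4 => /vlineP.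
have [l el] := line _ (mem_brkv v h3).
pose v' := v - l *: u.
have g : generates [:: u; v'].
  apply: (generates2 (p := 1) (q := 0) (r := - l) (s := 1) g0).
  - by rewrite mul0r mulr1 subr0 oner_neq0.
  - by apply: mem_eq0; lmod.
  - by apply: mem_eq0; rewrite /v'; lmod.
have v3 : v' ** x3 = 0 by rewrite /v' !brkE el; apply: subrr.
clearbody v'; move: v' g v3 => {}v g v3 {el l g0}.
have D34 : gam A 1 = (<[x3]> + <[x4]>)%VS by rewrite D3 D4.
have comb z : z \in gam A 1 -> exists p q, z = p *: x3 + q *: x4.
  by rewrite D34 => /memv_addP[_ /vlineP[p ->] [_ /vlineP[q ->] ->]]; exists p, q.
have [b1 l3] := line _ (@brk_gam _ _ 1 0 _ u h3 (memvf _)).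
have [b2 z3] := line _ (@brk_gam _ _ 1 0 _ v h3 (memvf _)).
have [f11 [g11 uu]] := comb _ (gam1E u u).
have [f12 [g12 uv]] := comb _ (gam1E u v).
have [f21 [g21 vu]] := comb _ (gam1E v u).
have [f22 [g22 vv]] := comb _ (gam1E v v).
have u33 : u ** x3 = x4 by [].
clearbody x4.
have k4 y : y ** x4 = 0 by apply: brk_deep.
have l4 y : x4 ** y = 0 by apply: deep_brk.
have coef (p : F) : p *: x4 = 0 -> p = 0.
  by move/eqP; rewrite scaler_eq0 (negPf u3) orbF => /eqP.
have left3 y : x3 ** u = 0 -> x3 ** v = 0 -> x3 ** y = 0.
  move=> hu hv; suff : y \in lker (linfun (brk A x3)) by rewrite memv_ker lfunE => /eqP.
  apply: (generates_mem g) => [x|].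
    by rewrite !inE => /orP[]/eqP->; rewrite memv_ker lfunE /= ?hu ?hv.
  by apply/subvP => x xD; rewrite memv_ker lfunE /= derived_brk.
(* the Leibniz identity on u and v, read off in the coefficient of x4 *)
have e111 : f11 * b1 = 0.
  by apply: coef; rewrite -(brk_square u u) uu !brkE l3 l4; lmod.
have e112 : f11 * b2 = 0.
  by apply: coef; rewrite -(brk_square u v) uu !brkE z3 l4; lmod.
have e221 : f22 * b1 = 0.
  by apply: coef; rewrite -(brk_square v u) vv !brkE l3 l4; lmod.
have e222 : f22 * b2 = 0.
  by apply: coef; rewrite -(brk_square v v) vv !brkE z3 l4; lmod.
have e121 : f21 - f12 * b1 = 0.
  apply: coef; have := brk_left u v u; rewrite uv vu uu !brkE l3 u33 v3 !k4 l4 => e.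
  transitivity (f21 *: x4 - (f12 * b1) *: x4); first by lmod.
  rewrite -scalerA; move: e; rewrite !scaler0 !addr0 subr0 => ->; exact: subrr.
have e122 : f22 - f12 * b2 = 0.
  apply: coef; have := brk_left u v v; rewrite uv vv !brkE z3 u33 v3 !k4 l4 => e.
  transitivity (f22 *: x4 - (f12 * b2) *: x4); first by lmod.
  rewrite -scalerA; move: e; rewrite !scaler0 !addr0 subr0 => ->; exact: subrr.
have e211 : f21 * b1 + f21 = 0.
  apply: coef; have := brk_left v u u; rewrite vu uu !brkE l3 u33 v3 !k4 l4 => e.
  by rewrite scalerDl -scalerA; move: e; rewrite !scaler0 !addr0 sub0r => ->;
    apply: addNr.
have [f120|f120] := eqVneq f12 0.
  have f210 : f21 = 0 by rewrite -[f21](subrK (f12 * b1)) e121 f120; ring.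
  have f220 : f22 = 0 by rewrite -[f22](subrK (f12 * b2)) e122 f120; ring.
  have f110 : f11 != 0.
    apply: contraNneq n3 => f110; apply: (subvP _ x3 h3).
    apply: brkv_sub => a b _.
    have /memv_addP[a1 a1X [a2 a2D ->]] : a \in (<<[:: u;
      v]>> + gam A 1)%VS by rewrite g memvf.
    have /memv_addP[b1' b1X [b2' b2D ->]] : b \in (<<[:: u;
      v]>> + gam A 1)%VS by rewrite g memvf.
    rewrite !brkE (derived_brk a2D b2D) addr0.
    rewrite !rpredD ?(mem_brkv a1 b2D) ?(@brk_gam _ _ 1 0 _ _ a2D (memvf _)) //.
    apply: (brk_span _ a1X b1X) => x y; rewrite !inE => /orP[]/eqP-> /orP[]/eqP->.
    - by rewrite uu f110 scale0r add0r rpredZ.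
    - by rewrite uv f120 scale0r add0r rpredZ.
    - by rewrite vu f210 scale0r add0r rpredZ.
    - by rewrite vv f220 scale0r add0r rpredZ.
  have b10 : b1 = 0 by move/eqP: e111; rewrite mulf_eq0 (negPf f110) => /eqP.
  have b20 : b2 = 0 by move/eqP: e112; rewrite mulf_eq0 (negPf f110) => /eqP.
  rewrite b10 scale0r in l3; rewrite b20 scale0r in z3.
  apply: (@square_chain u v (f11 *: x3 + g11 *: x4) (f11 *: x4)
    (g12 / f11) (g22 / f11) (g21 / f11) g).
  - by rewrite D34 line_sum_change.
  - exact: rpredZ.
  - by move=> y; rewrite !brkE left3 // l4; lmod.
  - by [].
  - by rewrite !brkE u33 k4; lmod.
  - by rewrite !brkE v3 k4; lmod.
  - by rewrite uv f120; lmod; fieldz.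
  - by rewrite vu f210; lmod; fieldz.
  - by rewrite vv f220; lmod; fieldz.
have b20 : b2 = 0.
  have /eqP : f12 * (b2 * b2) = 0.
    transitivity (f22 * b2 - (f22 - f12 * b2) * b2); first by ring.
    by rewrite e222 e122; ring.
  by rewrite mulf_eq0 (negPf f120) mulf_eq0 orbb => /eqP.
have f220 : f22 = 0 by rewrite -[f22](subrK (f12 * b2)) e122 b20; ring.
rewrite b20 scale0r in z3.
have [b10|b10] := eqVneq b1 0.
  have f210 : f21 = 0 by rewrite -[f21](subrK (f12 * b1)) e121 b10; ring.
  rewrite b10 scale0r in l3.
  pose s := f11 / f12; pose u' := u - s *: v.
  have uv' : u' ** v = f12 *: x3 + (g12 - s * g22) *: x4.
    by rewrite /u' !brkE uv vv f220; lmod.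
  have g' : generates [:: u'; v].
    apply: (generates2 (p := 1) (q := - s) (r := 0) (s := 1) g).
    - by rewrite mulr1 mulr0 subr0 oner_neq0.
    - by apply: mem_eq0; rewrite /u'; lmod.
    - by apply: mem_eq0; lmod.
  apply: (@left_null_chain u' v (f12 *: x3 + (g12 - s * g22) *: x4) (f12 *: x4)
    ((g11 - s * (g12 + g21) + s * s * g22) / f12) (g22 / f12) ((g21 - s * g22) / f12) g').
  - by rewrite -uv' gam1E.
  - exact: rpredZ.
  - by move=> y; rewrite !brkE left3 // l4; lmod.
  - by [].
  - by rewrite /u' !brkE u33 v3 !k4; lmod.
  - by rewrite !brkE v3 k4; lmod.
  - by rewrite /u' !brkE uu uv vu vv f210 f220; lmod; rewrite /s; fieldz.
  - by rewrite /u' !brkE vu vv f210 f220; lmod; fieldz.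
  - by rewrite vv f220; lmod; fieldz.
have f110 : f11 = 0 by move/eqP: e111; rewrite mulf_eq0 (negPf b10) orbF => /eqP.
have f21E : f21 = f12 * b1 by apply/eqP; rewrite -subr_eq0 e121.
have b1N : b1 = -1.
  apply/eqP; rewrite -addr_eq0; move/eqP: e211.
  rewrite (_ : _ + _ = (f12 * b1) * (b1 + 1)); last by rewrite f21E; ring.
  by rewrite !mulf_eq0 (negPf f120) (negPf b10).
apply: (@skew_chain u v (f12 *: x3 + g12 *: x4) (f12 *: x4)
    (g11 / f12) (g22 / f12) ((g12 + g21) / f12) g).
- by rewrite D34 line_sum_change.
- exact: rpredZ.
- by [].
- by rewrite !brkE u33 k4; lmod.
- by rewrite !brkE v3 k4; lmod.
- by rewrite !brkE l3 l4 b1N; lmod.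
- by rewrite !brkE z3 l4; lmod.
- by rewrite uu f110; lmod; fieldz.
- by rewrite vu f21E b1N; lmod; fieldz.
- by rewrite vv f220; lmod; fieldz.
Qed.

End ClassThree.

(** * The classification *)

Lemma classification (F : fieldType) (A : leibnizAlg F) :
    2 != 0 :> F -> (forall a : F, exists b, b * b = a) ->
    \dim {:A} = 4%N -> nilpotent_leibniz A -> non_lie A -> ~ split_leibniz A ->
  classified A.
Proof.
move=> two_neq0 sqrtF dimA nilA /non_lie_square[x xx] nonsplit.
have nonlie : exists a : A, a ** a != 0 by exists x.
have d4 : (\dim (gam A 1) < 4)%N.
  by rewrite -dimA; apply: (@dim_gamS _ _ nilA 0); rewrite -dimv_eq0 dimA.
have d0 : gam A 1 != 0%VS.
  by apply: contraNneq xx => D0; rewrite -memv0 -D0 gam1E.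
have d21 := dim_gamS nilA d0.
move: d0; rewrite -dimv_eq0 => d0.
have /or3P[] : [|| \dim (gam A 1) == 1, \dim (gam A 1) == 2 | \dim (gam A 1) == 3]%N by lia.
- by move=> /eqP; apply: derived_line.
- move=> /eqP d2; rewrite d2 in d21; have [g2|] := eqVneq (gam A 2) 0%VS.
    exact: class_two.
  by rewrite -dimv_eq0 => n2; apply: class_three => //; lia.
move=> /eqP d3; have [X] := @exists_generates _ A 1 (ltac:(by rewrite dimA d3)).
by case: X => [|u []] // _ /(one_generator dimA nilA).
Qed.

Theorem mainTheorem1 (R : realType) :
  (forall A : leibnizAlg R[i],
     \dim (fullv : {vspace A}) = 4%N ->
     nilpotent_leibniz A -> non_lie A -> ~ split_leibniz A ->
     exists k : nat, (1 <= k <= 25)%N /\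
       exists B : leibnizAlg R[i], of_class k B /\ leibniz_iso A B)
  /\
  (forall (i j : nat) (B B' : leibnizAlg R[i]),
     (1 <= i <= 25)%N -> (1 <= j <= 25)%N -> i <> j ->
     of_class i B -> of_class j B' -> ~ leibniz_iso B B').
Proof.
have two_neq0 : 2 != 0 :> R[i] by rewrite pnatr_eq0.
have sqrtF (a : R[i]) : exists b, b * b = a.
  by exists (sqrtC a); rewrite -expr2 sqrtCK.
split=> [A dimA nilA nlA nsA | i j B B' hi hj ij Bi Bj iso].
  have [k hk Ak] := classification two_neq0 sqrtF dimA nilA nlA nsA.
  exists k; split=> //; exists A; split=> //.
  by exists (idfun : {linear A -> A}); split; first by exists idfun.
by apply: ij; apply: (of_class_inj two_neq0 sqrtF hi hj Bi Bj iso).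
Qed.
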